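(* There exists a systolic group which is not residually finite.
   Context: A generalised simplicial complex (called ''simplicial complex'' here) is a set of affine simplices together with a set, closed under composition, of affine embeddings (attaching maps) of simplices onto faces of simplices, such that for each proper face of each simplex there is precisely one attaching map onto it; the geometric realisation is the quotient (simplices need not be embedded). The link of a simplex $\sigma$ has one simplex for each attaching map of $\sigma$ onto a proper face of a simplex $\tau$, namely the face of $\tau$ spanned by the vertices not in the image of $\sigma$, with the restricted attaching maps. A simplicial complex is simple if it has no edge joining a vertex to itself and no two distinct simplices of positive dimension with the same boundary. A simple complex is flag if every finite clique of its $1$-skeleton spans a simplex. A cycle without diagonals is an embedded simplicial loop such that no edge of the complex connects two nonconsecutive vertices of it. A simplicial complex is locally $6$-large if all its vertex links are (simple and) flag and contain no cycles of length $4$ or $5$ without diagonals. A systolic complex is a (nonempty) connected, simply connected locally $6$-large simplicial complex. A group is systolic if it acts geometrically (properly and cocompactly, by simplicial automorphisms) on a systolic complex. *)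

(* Defs.v *)
From HB Require Import structures.
From Stdlib Require Import Relation_Operators.
From mathcomp Require Import all_boot all_order all_algebra all_fingroup.
From mathcomp Require Import generic_quotient.
From mathcomp Require Import all_classical all_reals.
From mathcomp Require Import topology normedtype.
Import Order.TTheory GRing.Theory Num.Theory numFieldNormedType.Exports.

Set Implicit Arguments.
Unset Strict Implicit.
Unset Printing Implicit Defensive.

Local Open Scope classical_set_scope.
Local Open Scope ring_scope.
Local Open Scope quotient_scope.

(* An affine simplex is given by its finite nonempty set of vertices, a face by
   a nonempty set of vertices, and an affine embedding onto a face by an
   injection between vertex sets; the dimension of [s] is [#|vert s|.-1].
   [attach] consists of the attaching maps onto proper faces; identity maps are
   not listed. *)
Record gcomplex : Type := GComplex {
  simplex : choiceType;
  vert : simplex -> finType;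
  attach : forall s t : simplex, set (vert s -> vert t);
  vert_gt0 : forall s, (0 < #|vert s|)%N;
  attach_inj : forall s t (f : vert s -> vert t), attach f -> injective f;
  attach_proper : forall s t (f : vert s -> vert t),
    attach f -> range f <> setT;
  attach_comp : forall s t u (f : vert s -> vert t) (g : vert t -> vert u),
    attach f -> attach g -> attach (g \o f);
  attach_face : forall t (A : set (vert t)), A !=set0 -> A <> setT ->
    exists! p : {s : simplex & vert s -> vert t},
      attach (projT2 p) /\ range (projT2 p) = A
}.

Section Link.
Variables (X : gcomplex) (s : simplex X).

Definition link_simplex : choiceType :=
  {t : simplex X & set_type (@attach X s t)}.

Definition link_map (p : link_simplex) : vert s -> vert (projT1 p) :=
  set_val (projT2 p).

Definition link_vert (p : link_simplex) : finType :=
  {x : vert (projT1 p) | x \notin codom (link_map p)}.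

Definition link_attach (p q : link_simplex) :
    set (link_vert p -> link_vert q) :=
  [set k | exists g : vert (projT1 p) -> vert (projT1 q),
    [/\ attach g, g \o link_map p = link_map q &
        forall x, val (k x) = g (val x)]].

Lemma link_map_attach p : attach (link_map p).
Proof. by case: p => t f; exact: set_valP. Qed.

Lemma link_vert_gt0 p : (0 < #|link_vert p|)%N.
Proof.
have [x Hx] : exists x, x \notin codom (link_map p).
  apply: contrapT => H; apply: (attach_proper (link_map_attach p)).
  rewrite predeqE => x; split=> // _.
  apply: contrapT => nx; apply: H; exists x; apply/codomP => -[y ey].
  by apply: nx; exists y.
by apply/card_gt0P; exists (Sub x Hx).
Qed.

Lemma link_attach_inj p q (k : link_vert p -> link_vert q) :
  link_attach k -> injective k.
Proof.
move=> [g [ag _ kE]] x y /(congr1 val); rewrite !kE.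
by move/(attach_inj ag)/val_inj.
Qed.

Lemma link_attach_proper p q (k : link_vert p -> link_vert q) :
  link_attach k -> range k <> setT.
Proof.
move=> [g [ag gE kE]] kT; apply: (attach_proper ag).
rewrite predeqE => y; split=> // _.
case: (boolP (y \in codom (link_map q))) => [/codomP[x ->]|ny].
  by exists (link_map p x) => //; rewrite -gE.
have [x _ kx] : range k (Sub y ny) by rewrite kT.
by exists (val x) => //; rewrite -kE kx SubK.
Qed.

Lemma link_attach_comp p q r (k : link_vert p -> link_vert q)
    (l : link_vert q -> link_vert r) :
  link_attach k -> link_attach l -> link_attach (l \o k).
Proof.
move=> [g [ag gE kE]] [h [ah hE lE]]; exists (h \o g); split.
- exact: attach_comp.
- by rewrite -hE -gE.
- by move=> x /=; rewrite lE kE.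
Qed.

Lemma link_attach_face q (A : set (link_vert q)) : A !=set0 -> A <> setT ->
  exists! k : {p : link_simplex & link_vert p -> link_vert q},
    link_attach (projT2 k) /\ range (projT2 k) = A.
Proof.
move=> [a0 Aa0] AT.
pose B : set (vert (projT1 q)) := range (link_map q) `|` (val @` A).
have B0 : B !=set0 by exists (val a0); right; exists a0.
have BA (x : link_vert q) : B (val x) -> A x.
  case=> [[y _ yx]|[y Ay /val_inj <-//]].
  by have := valP x; rewrite -yx codom_f.
have BT : B <> setT.
  by move=> BT; apply: AT; rewrite predeqE => x; split=> // _; apply: BA;
     rewrite BT.
have [[t g] [[/= ag gB] guniq]] := attach_face B0 BT.
pose C : set (vert t) := [set x | range (link_map q) (g x)].
have C0 : C !=set0.
  have /card_gt0P[y _] := vert_gt0 s.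
  have [x _ gx] : range g (link_map q y) by rewrite gB; left; exists y.
  by exists x; rewrite /C /= gx; exists y.
have CT : C <> setT.
  move=> CT; have [x _ gx] : range g (val a0) by rewrite gB; right; exists a0.
  have [y _ yx] : C x by rewrite CT.
  by have := valP a0; rewrite -gx -yx codom_f.
have [[s' h] [[/= ah hC] _]] := attach_face C0 CT.
have ghq : range (g \o h) = range (link_map q).
  rewrite predeqE => y; split=> [[x _ <-]|[x _ <-]].
    by have : C (h x) by rewrite -hC; exists x.
  have [z _ gz] : range g (link_map q x) by rewrite gB; left; exists x.
  have [w _ hw] : range h z by rewrite hC /C /= gz; exists x.
  by exists w => //=; rewrite hw.
have qT : range (link_map q) <> setT := attach_proper (link_map_attach q).
have q0 : range (link_map q) !=set0.
  by have /card_gt0P[y _] := vert_gt0 s; exists (link_map q y); exists y.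
have [m [_ muniq]] := attach_face q0 qT.
have m1 := muniq (existT _ s (link_map q)) (conj (link_map_attach q) erefl).
have m2 := muniq (existT _ s' (g \o h)) (conj (attach_comp ah ag) ghq).
have {m1 m2 muniq m} E := etrans (esym m1) m2.
have [f [af fE]] : exists f : vert s -> vert t,
    attach f /\ g \o f = link_map q.
  pose P (p : {s : simplex X & vert s -> vert (projT1 q)}) :=
    exists f : vert (projT1 p) -> vert t, attach f /\ g \o f = projT2 p.
  have : P (existT _ s' (g \o h)) by exists h.
  by rewrite -E.
pose p : link_simplex := existT _ t (SigSub (mem_set af)).
have pE : link_map p = f by [].
have kP (x : link_vert p) : g (val x) \notin codom (link_map q).
  apply/negP => /codomP[y]; rewrite -fE => /(attach_inj ag) xy.
  by have := valP x; rewrite xy pE codom_f.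
pose k (x : link_vert p) : link_vert q := Sub (g (val x)) (kP x).
exists (existT _ p k); split.
  split=> /=; first by exists g; split=> //; move=> x; rewrite SubK.
  rewrite predeqE => y; split=> [[x _ <-]|Ay].
    apply: BA; rewrite SubK -gB; by exists (val x).
  have [x _ gx] : range g (val y) by rewrite gB; right; exists y.
  have nx : x \notin codom (link_map p).
    apply/negP => /codomP[z xz]; have := valP y; rewrite -gx xz.
    by rewrite -fE pE codom_f.
  by exists (Sub x nx) => //; apply: val_inj; rewrite !SubK.
move=> [[t' f'] k'] [/= [g' [/= ag' gE' kE']] kA'].
have g'B : range g' = B.
  rewrite predeqE => y; split=> [[x _ <-]|[[z _ <-]|[z Az <-]]].
  - case: (boolP (x \in codom (link_map (existT _ t' f')))) => [/codomP[z ->]|nx].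
      by left; exists z => //; rewrite -gE'.
    by right; exists (k' (Sub x nx)); [rewrite -kA'; exists (Sub x nx)
      | exact: (kE' (Sub x nx))].
  - by rewrite -gE'; exists (link_map (existT _ t' f') z).
  - by move: Az; rewrite -kA' => -[x _ <-]; exists (val x); rewrite -?kE'.
suff H (r : {u : simplex X & vert u -> vert (projT1 q)}) :
    existT _ t g = r ->
    forall (m : set_type (@attach X s (projT1 r)))
      (l : link_vert (existT _ (projT1 r) m) -> link_vert q),
    projT2 r \o set_val m = link_map q ->
    (forall x, val (l x) = projT2 r (val x)) ->
    existT (fun p => link_vert p -> link_vert q) p k =
      existT _ (existT _ (projT1 r) m) l.
  exact: (H (existT _ t' g') (guniq (existT _ t' g') (conj ag' g'B)) f' k').
move=> <- /= m l mE lE.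
have {}mE : m = SigSub (mem_set af).
  apply: val_inj => /=; apply: funext => x; apply: (attach_inj ag).
  by have := congr1 (@^~ x) mE; rewrite -fE.
subst m; congr (existT _ _ _); apply: funext => x; apply: val_inj.
by rewrite SubK; exact: esym (lE x).
Qed.

Definition link : gcomplex :=
  GComplex link_vert_gt0 link_attach_inj link_attach_proper link_attach_comp
    link_attach_face.

End Link.

Section LocallySixLarge.
Variable X : gcomplex.
Implicit Types (e s t v w : simplex X).

Definition is_vertex v := #|vert v| = 1%N.

Definition is_edge e := #|vert e| = 2%N.

(* The ranges of [f] and [g] are singletons, so the last condition says that
   they are the two ends of [e]; [v = w] is allowed. *)
Definition joins e v w := [/\ is_edge e, is_vertex v, is_vertex w &
  exists (f : vert v -> vert e) (g : vert w -> vert e),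
    [/\ attach f, attach g & range f `|` range g = setT]].

Definition adjacent v w := exists e, joins e v w.

(* The boundary as a subcomplex. In the realization two simplices have the same
   image of their topological boundary iff these sets agree, since the
   realization is the disjoint union of the open simplices. *)
Definition boundary s : set (simplex X) :=
  [set t | exists f : vert t -> vert s, attach f].

Definition vertices_of s : set (simplex X) :=
  [set v | is_vertex v /\ (v = s \/ boundary s v)].

Definition simple :=
  (forall e v, ~ joins e v v) /\
  (forall s t, (1 < #|vert s|)%N -> (1 < #|vert t|)%N ->
    boundary s = boundary t -> s = t).

Definition clique (K : set (simplex X)) :=
  K `<=` is_vertex /\
  (forall v w, K v -> K w -> v <> w -> adjacent v w).

Definition flag := simple /\
  forall K : set (simplex X), finite_set K -> K !=set0 -> clique K ->
    exists s, vertices_of s = K.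

(* A loop through distinct vertices, given by its vertices in cyclic order; it
   is only used in simple complexes, where these determine the edges. *)
Definition cycle_without_diagonals n (c : 'I_n -> simplex X) :=
  [/\ forall i, is_vertex (c i), injective c,
      forall i, adjacent (c i) (c (ordS i)) &
      forall i j, j <> i -> j <> ordS i -> i <> ordS j ->
        ~ adjacent (c i) (c j)].

End LocallySixLarge.

Definition locally_6_large (X : gcomplex) :=
  forall v : simplex X, is_vertex v ->
    flag (link v) /\
    (forall n (c : 'I_n -> simplex (link v)), n = 4%N \/ n = 5%N ->
      ~ cycle_without_diagonals c).

Section StandardSimplex.
Variable R : realType.

Definition std_simplex (V : finType) : set {ptws V -> R} :=
  [set a | (forall x, 0 <= a x) /\ \sum_x a x = 1].

(* affine extension of [f], in barycentric coordinates *)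
Definition push (V W : finType) (f : V -> W) (a : V -> R) : W -> R :=
  fun y => \sum_(x | f x == y) a x.

Lemma push_std (V W : finType) (f : V -> W) a :
  std_simplex a -> std_simplex (push f a).
Proof.
move=> [a0 a1]; split=> [y|]; first by apply: sumr_ge0.
by rewrite -a1 (partition_big f predT).
Qed.

Lemma push_comp (U V W : finType) (f : U -> V) (g : V -> W) a :
  push (g \o f) a = push g (push f a).
Proof.
apply: funext => z; rewrite /push (partition_big f (fun y => g y == z)) //=.
apply: eq_bigr => y /eqP gy; apply: eq_bigl => x.
by case: (f x =P y) => [->|_]; rewrite ?andbF ?gy ?eqxx.
Qed.

Definition std_push (V W : finType) (f : V -> W)
    (a : set_type (@std_simplex V)) : set_type (@std_simplex W) :=
  SigSub (mem_set (push_std f (set_valP a))).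

End StandardSimplex.

Section Realization.
Variables (R : realType) (X : gcomplex).

Definition simplex_points : topologicalType :=
  {s : simplex X & set_type (@std_simplex R (vert s))}.

Definition glue (p q : simplex_points) : Prop :=
  exists f : vert (projT1 p) -> vert (projT1 q),
    attach f /\ projT2 q = std_push f (projT2 p).

Definition glue_equiv (p q : simplex_points) : bool :=
  `[< clos_refl_sym_trans _ glue p q >].

Lemma glue_equiv_refl : reflexive glue_equiv.
Proof. by move=> p; apply/asboolP; exact: rst_refl. Qed.

Lemma glue_equiv_sym : symmetric glue_equiv.
Proof. by move=> p q; apply/asboolP/asboolP; exact: rst_sym. Qed.

Lemma glue_equiv_trans : transitive glue_equiv.
Proof.
by move=> q p r /asboolP pq /asboolP qr; apply/asboolP; exact: rst_trans qr.
Qed.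

Canonical glue_equivRel :=
  EquivRel glue_equiv glue_equiv_refl glue_equiv_sym glue_equiv_trans.

Definition realization : topologicalType :=
  quotient_topology {eq_quot glue_equivRel}.

End Realization.

Section Topology.
Variables (R : realType) (T : topologicalType).

Definition is_loop (x : T) (c : R -> T) :=
  [/\ {within `[0, 1], continuous c}, c 0 = x & c 1 = x].

Definition null_homotopic (x : T) (c : R -> T) :=
  exists H : R * R -> T,
    [/\ {within `[0, 1] `*` `[0, 1], continuous H},
        forall t : R, t \in `[0, 1] -> H (0, t) = c t,
        forall t : R, t \in `[0, 1] -> H (1, t) = x &
        forall u : R, u \in `[0, 1] -> H (u, 0) = x /\ H (u, 1) = x].

Definition simply_connected :=
  forall (x : T) (c : R -> T), is_loop x c -> null_homotopic x c.

End Topology.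

Definition systolic (R : realType) (X : gcomplex) :=
  [/\ [set: realization R X] !=set0,
      connected [set: realization R X],
      simply_connected R (realization R X) &
      locally_6_large X].

Record automorphism (X : gcomplex) : Type := Automorphism {
  aut_simplex :> simplex X -> simplex X;
  aut_vert : forall s, vert s -> vert (aut_simplex s);
  aut_simplex_bij : bijective aut_simplex;
  aut_vert_bij : forall s, bijective (@aut_vert s);
  aut_attach : forall s t (f : vert s -> vert t)
      (f' : vert (aut_simplex s) -> vert (aut_simplex t)),
    f' \o @aut_vert s = @aut_vert t \o f -> (attach f <-> attach f')
}.

Arguments aut_vert {X} _ s _.

Section AutomorphismRealization.
Variables (R : realType) (X : gcomplex) (phi : automorphism X).

Definition aut_points (p : simplex_points R X) : simplex_points R X :=
  existT _ (phi (projT1 p)) (std_push (aut_vert phi (projT1 p)) (projT2 p)).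

Definition aut_real (x : realization R X) : realization R X :=
  \pi_(realization R X) (aut_points (repr x)).

Lemma aut_points_glue p q : glue p q -> glue (aut_points p) (aut_points q).
Proof.
case: p q => [s a] [t b] [/= f [af ->]].
have [h hK _] := aut_vert_bij phi s.
exists (aut_vert phi t \o f \o h); split.
  by apply/(aut_attach (f := f)) => //; apply: funext => x /=; rewrite hK.
apply: val_inj => /=; rewrite -!push_comp; congr push.
by apply: funext => x /=; rewrite hK.
Qed.

Lemma aut_real_pi p :
  aut_real (\pi_(realization R X) p) = \pi_(realization R X) (aut_points p).
Proof.
have : glue_equiv (repr (\pi_(realization R X) p)) p.
  by apply/eqquotP; exact: (@reprK _ (realization R X)).
rewrite /aut_real; move: (repr _) => q /asboolP H; apply/eqquotP/asboolP.
elim: H => [u v uv|u|u v _ uv|u v w _ uv _ vw].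
- by apply: rst_step; exact: aut_points_glue uv.
- exact: rst_refl.
- exact: rst_sym.
- exact: rst_trans vw.
Qed.

End AutomorphismRealization.

Section GeometricAction.
Variables (G : groupType) (X : gcomplex) (rho : G -> automorphism X).

Definition corner : Type := {s : simplex X & vert s}.

Definition aut_corner (phi : automorphism X) (c : corner) : corner :=
  existT _ (phi (projT1 c)) (aut_vert phi (projT1 c) (projT2 c)).

(* An automorphism is determined by its effect on the pairs of a simplex and a
   vertex of it. *)
Definition is_action :=
  (forall c, aut_corner (rho 1%g) c = c) /\
  (forall g h c,
    aut_corner (rho (g * h)%g) c = aut_corner (rho g) (aut_corner (rho h) c)).

Variable R : realType.

Definition proper_action :=
  forall K : set (realization R X), compact K ->
    finite_set [set g | (aut_real (rho g) @` K) `&` K !=set0].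

Definition cocompact_action :=
  exists2 K : set (realization R X), compact K &
    \bigcup_g (aut_real (rho g) @` K) = setT.

End GeometricAction.

Definition systolic_group (R : realType) (G : groupType) :=
  exists (X : gcomplex) (rho : G -> automorphism X),
    [/\ systolic R X, is_action rho, proper_action rho R &
        cocompact_action rho R].

Definition residually_finite (G : groupType) :=
  forall g : G, g <> 1%g ->
    exists (F : finGroupType) (f : {multiplicative G -> F}), f g <> 1%g.

(* Main.v *)
(* The group is a lattice in a product of two trees, and the complex is a
   systolic thickening of this product, in the spirit of the theorem of Elsner
   and Przytycki on VH-complexes.

   Let A be the free product of three groups of order 2 and let X be a free
   group, acting on each other's words by a bireversible automaton (the
   Bellaterra automaton). Squares a x = x' a' define a group which is the
   product A X as a set and acts simply transitively on the pairs of reduced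
   words, that is, on the vertices of the product of the Cayley trees of A and
   X. We use the alphabet of the automaton twice: X is free on x_0, y_0, x_1, y_1
   and A acts on both copies in the same way.

   Not residually finite: let w be a word in a, b, c with an odd number of c and
   an odd number of other letters, and f a morphism to a finite group. Such a w
   exchanges the letters x and y, and w^2 x = x w' with w' of the same kind; so
   some conjugate v of the power of w killed by f is again a word of A exchanging
   x and y. From v x_k = y_k v', with v' independent of k, f(y_k^-1 x_k) = f(v')
   does not depend on k, whereas y_0^-1 x_0 <> y_1^-1 x_1.

   Systolic: on the pairs (p, q) of even total level, join (p, q) to (p', q')
   when p ~ p' and q ~ q', or when q = q' and p, p' have a common neighbour. The
   link of (p, q) in the clique complex consists of cliques A_v for v ~ p and
   B_w = {(v, w) : v ~ p} for w ~ q, each A_v being joined to (v, w) for all w; a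
   cycle without diagonals meets A's and B's alternately, uses an edge of every
   B it meets, and so has length at least 6. The complex is contracted by first
   shortening p, two levels at a time, and then q.

   The topology of the realization is controlled by the barycentric coordinates:
   a map with values in a finite subcomplex is continuous as soon as its
   coordinates are, since finite subcomplexes are compact. *)
Require Import Defs.
From HB Require Import structures.
From Stdlib Require Import Relation_Operators.
From mathcomp Require Import all_boot all_order all_algebra all_fingroup.
From mathcomp Require Import cyclic finmap generic_quotient.
From mathcomp Require Import all_classical all_reals.
From mathcomp Require Import topology normedtype.
From mathcomp Require Import ring lra zify.

Set Implicit Arguments.
Unset Strict Implicit.
Unset Printing Implicit Defensive.

(** * The graph of a product of two trees *)

(** The root is the only vertex of level 0, so [parent] fixes it; edges are therefore tested with
    [0 < level]. The lists [children] express local finiteness. *)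
Record rooted_tree := RootedTree {
  node :> choiceType;
  parent : node -> node;
  level : node -> nat;
  root : node;
  children : node -> seq node;
  level_parent : forall v, level (parent v) = (level v).-1;
  level_eq0 : forall v, level v = 0 -> v = root;
  level_root : level root = 0;
  childrenP : forall v, 0 < level v -> v \in children (parent v)
}.

Section Trees.
Variable T : rooted_tree.
Implicit Types u v w : T.

Definition tadj u v :=
  (parent u == v) && (0 < level u) || (parent v == u) && (0 < level v).

Lemma tadjC u v : tadj u v = tadj v u.
Proof. by rewrite /tadj orbC. Qed.

Lemma tadjP u v :
  tadj u v -> (parent u = v /\ level u = (level v).+1)
           \/ (parent v = u /\ level v = (level u).+1).
Proof.
by case/orP=> /andP[/eqP <- h]; [left|right]; rewrite level_parent prednK.
Qed.

Lemma tadj_parent v : 0 < level v -> tadj v (parent v).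
Proof. by move=> v0; rewrite /tadj eqxx v0. Qed.

Lemma odd_tadj u v : tadj u v -> odd (level v) = ~~ odd (level u).
Proof. by case/tadjP=> -[_ ->]; rewrite ?negbK. Qed.

(** On a closed walk in a tree, both neighbours of a vertex of highest level are its parent. Here
    this vertex cannot be [v] or [v'], since [u <> u'], so it is [u] or [u'], and [v = v']. The same
    argument folds the hexagon of [tadj_hexagon] to a square. *)
Lemma tadj_middle u u' v v' :
  tadj u v -> tadj v u' -> tadj u v' -> tadj v' u' -> u <> u' -> v = v'.
Proof.
move=> /tadjP uv /tadjP vu' /tadjP uv' /tadjP v'u' uu'.
case: uv vu' uv' v'u' => -[? ?] [] [? ?] [] [? ?] [] [? ?]; subst => //;
  exfalso; solve [lia | congruence].
Qed.

Lemma tadj_hexagon u v u' a u'' v' :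
  tadj u v -> tadj v u' -> tadj u' a -> tadj a u'' -> tadj u'' v' ->
  tadj v' u -> u <> u' -> u <> u'' -> u' <> u'' -> v = v'.
Proof.
move=> /tadjP h1 /tadjP h2 /tadjP h3 /tadjP h4 /tadjP h5 /tadjP h6 n1 n2 n3.
case: h1 h2 h3 h4 h5 h6 =>
  -[? ?] [] [? ?] [] [? ?] [] [? ?] [] [? ?] [] [? ?]; 
  solve [exfalso; lia | congruence].
Qed.

(** Distance 0 or 2 in the tree: a grandparent or a grandchild counts as well. *)
Definition siblings u v := (u == v) || `[< exists a, tadj u a /\ tadj a v >].

Lemma siblings_refl u : siblings u u.
Proof. by rewrite /siblings eqxx. Qed.

Lemma siblingsC u v : siblings u v = siblings v u.
Proof.
rewrite /siblings eq_sym; congr (_ || _); apply/asboolP/asboolP;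
  by move=> [a [h1 h2]]; exists a; split; rewrite tadjC.
Qed.

Lemma siblings_middle a u v : tadj u a -> tadj a v -> siblings u v.
Proof. by move=> h1 h2; apply/orP; right; apply/asboolP; exists a. Qed.

Lemma siblingsP u v :
  siblings u v -> u = v \/ exists a, tadj u a /\ tadj a v.
Proof. by case/orP=> [/eqP|/asboolP]; [left|right]. Qed.

Lemma odd_siblings u v : siblings u v -> odd (level v) = odd (level u).
Proof.
by case/siblingsP=> [->|[a [/odd_tadj h /odd_tadj ->]]] //; rewrite h negbK.
Qed.

Definition neighbours v := parent v :: children v.

Lemma mem_neighbours u v : tadj u v -> v \in neighbours u.
Proof.
case/orP=> /andP[/eqP <- h]; rewrite inE ?eqxx //.
by rewrite childrenP ?orbT.
Qed.

End Trees.

(** * The combinatorial model of a vertex link *)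

Section LinkRelation.
Variables (I J : Type) (j0 : J).
Implicit Types c d : I * J.

(** Codes for the vertices of the link of [(p, q)], with [j0 = q]: all elements of the clique [A_v]
    get the code [(v, j0)], and the element [(v, w)] of [B_w] is its own code. *)
Definition link_rel c d :=
  (c.1 = d.1 /\ (c.2 = j0 \/ d.2 = j0)) \/ (c.2 = d.2 /\ c.2 <> j0).

Lemma link_relC c d : link_rel c d -> link_rel d c.
Proof.
case=> [[e [h|h]]|[e h]]; rewrite /link_rel.
- by left; split; [|right].
- by left; split; [|left].
- by right; rewrite -e.
Qed.

(** An element of [A_v] is related only to codes with first entry [v], and to all of them. So of two
    unrelated neighbours neither is in [A_v], and they lie in different cliques [B_w]. *)
Lemma link_rel_fan c d d' : c.2 = j0 -> link_rel c d -> link_rel c d' ->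
  ~ link_rel d d' -> [/\ d.1 = c.1, d'.1 = c.1 & [/\ d.2 <> d'.2,
    d.2 <> j0 & d'.2 <> j0]].
Proof.
move=> cj [[e _]|[_ //]] [[e' _]|[_ //]] n; split=> //.
have dj : d.2 <> j0 by move=> h; apply: n; left; split; [rewrite -e|left].
split=> //.
- by move=> h; apply: n; right.
- by move=> h; apply: n; left; split; [rewrite -e|right].
Qed.

Lemma no_square_link_rel c0 c1 c2 c3 :
  link_rel c0 c1 -> link_rel c1 c2 -> link_rel c2 c3 -> link_rel c3 c0 ->
  ~ link_rel c0 c2 -> ~ link_rel c1 c3 -> False.
Proof.
(* For [d0] in [A_v], the vertices [d1] and [d3] are in different cliques [B_w]; as [d2] has a first
   entry other than [v], it would have to lie in both of them. *)
have key d0 d1 d2 d3 : d0.2 = j0 ->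
  link_rel d0 d1 -> link_rel d1 d2 -> link_rel d2 d3 -> link_rel d3 d0 ->
  ~ link_rel d0 d2 -> ~ link_rel d1 d3 -> False.
  move=> z l01 l12 l23 /link_relC l03 n02 n13.
  have [e1 e3 [n nj1 nj3]] := link_rel_fan z l01 l03 n13.
  have d02 : d0.1 <> d2.1 by move=> e; apply: n02; left; split; [|left].
  case: l12 => [[e _]|[e _]]; first by apply: d02; rewrite -e1.
  case: l23 => [[e' _]|[e' _]]; first by apply: d02; rewrite e'.
  by apply: n; rewrite e.
(* Either one of three consecutive vertices lies in some [A_v], and the cycle is rotated to start
   there, or all three lie in one clique [B_w], which gives a diagonal. *)
move=> l01 l12 l23 l30 n02 n13.
have [z|z] := pselect (c0.2 = j0); first exact: (key c0 c1 c2 c3).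
have [z1|z1] := pselect (c1.2 = j0).
  by apply: (key c1 c2 c3 c0) => // /link_relC.
have [z2|z2] := pselect (c2.2 = j0).
  by apply: (key c2 c3 c0 c1) => // /link_relC.
case: l01 => [[_ []//]|[e _]]; case: l12 => [[_ []//]|[e' _]].
by apply: n02; right; rewrite e.
Qed.

(** As for squares: if [c0] is in [A_v], then [c2] is in the clique [B_w] of [c1] and [c3] in the
    different one of [c4]. An edge from [c2] to [c3] would need the same [B_w] or an end in some
    [A_v]. *)
Lemma no_pentagon_link_rel c0 c1 c2 c3 c4 :
  link_rel c0 c1 -> link_rel c1 c2 -> link_rel c2 c3 -> link_rel c3 c4 ->
  link_rel c4 c0 -> ~ link_rel c0 c2 -> ~ link_rel c0 c3 ->
  ~ link_rel c1 c3 -> ~ link_rel c1 c4 -> ~ link_rel c2 c4 -> False.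
Proof.
have key d0 d1 d2 d3 d4 : d0.2 = j0 ->
  link_rel d0 d1 -> link_rel d1 d2 -> link_rel d2 d3 -> link_rel d3 d4 ->
  link_rel d4 d0 -> ~ link_rel d0 d2 -> ~ link_rel d0 d3 ->
  ~ link_rel d1 d4 -> False.
  move=> z l01 l12 l23 l34 /link_relC l04 n02 n03 n14.
  have [e1 e4 [n nj1 nj4]] := link_rel_fan z l01 l04 n14.
  have d02 : d0.1 <> d2.1 by move=> e; apply: n02; left; split; [|left].
  have d03 : d0.1 <> d3.1 by move=> e; apply: n03; left; split; [|left].
  case: l12 => [[e _]|[e _]]; first by apply: d02; rewrite -e1.
  case: l34 => [[e' _]|[e' _]]; first by apply: d03; rewrite e'.
  case: l23 => [[_]|[e'' _]]; first by rewrite -e e' => -[].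
  by apply: n; rewrite e e''.
move=> l01 l12 l23 l34 l40 n02 n03 n13 n14 n24.
have [z|z] := pselect (c0.2 = j0); first exact: (key c0 c1 c2 c3 c4).
have [z1|z1] := pselect (c1.2 = j0).
  by apply: (key c1 c2 c3 c4 c0) => // /link_relC.
have [z2|z2] := pselect (c2.2 = j0).
  by apply: (key c2 c3 c4 c0 c1) => // /link_relC.
case: l01 => [[_ []//]|[e _]]; case: l12 => [[_ []//]|[e' _]].
by apply: n02; right; rewrite e.
Qed.

End LinkRelation.

(** * The graph on the even vertices and its links *)

Section ProductGraph.
Variables T1 T2 : rooted_tree.
Notation V := (T1 * T2)%type.
Implicit Types x y : V.

Definition parity x := odd (level x.1 + level x.2).

(* The vertices of the complex are the [x] with [pgraph x x]. The maximal
   cliques are the sets [N(a) x {b}] together with one [(a, b')], where [N(a)] is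
   the set of neighbours of [a] and [b'] is a neighbour of [b]. *)
Definition pgraph : rel V := fun x y =>
  [&& ~~ parity x, ~~ parity y &
   (tadj x.1 y.1 && tadj x.2 y.2) || ((x.2 == y.2) && siblings x.1 y.1)].

Lemma pgraphC x y : pgraph x y = pgraph y x.
Proof.
rewrite /pgraph andbCA; congr [&& _, _ & _].
by rewrite tadjC [tadj x.2 _]tadjC eq_sym siblingsC.
Qed.

Lemma pgraph_refl x : ~~ parity x -> pgraph x x.
Proof. by rewrite /pgraph => ->; rewrite eqxx siblings_refl orbT. Qed.

Lemma pgraph_finite x :
  exists s : seq V, forall y, pgraph x y -> y \in s.
Proof.
pose n1 := x.1 :: neighbours x.1.
exists (allpairs pair (flatten [seq u :: neighbours u | u <- n1])
                      (x.2 :: neighbours x.2)).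
move=> [p q] /and3P[_ _] /orP[/andP[h1 h2]|/andP[/eqP e /siblingsP h]].
  apply/allpairsP; exists (p, q); split=> //; last first.
    by rewrite inE mem_neighbours ?orbT.
  apply/flatten_mapP; exists p; last by rewrite inE eqxx.
  by rewrite inE mem_neighbours ?orbT.
have {}e : x.2 = q := e; subst q.
apply/allpairsP; exists (p, x.2); split=> //; last by rewrite inE eqxx.
apply/flatten_mapP; case: h => [<-|[a [h1 h2]]].
  by exists x.1; rewrite inE eqxx.
by exists a; rewrite inE mem_neighbours // orbT.
Qed.

(* [v] is the middle of the path from [x.1] to [y.1] when these are at
   distance 2, and [y.1] when they are adjacent. *)
Definition link_middle x y v :=
  tadj x.1 v /\ ((y.2 = x.2 /\ tadj v y.1 /\ y.1 <> x.1) \/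
                 (y.1 = v /\ tadj x.2 y.2)).

Lemma link_pgraph x y : pgraph x y -> x <> y -> exists v, link_middle x y v.
Proof.
case/and3P=> _ _ /orP[/andP[h1 h2]|/andP[/eqP h2 /siblingsP h]] xy.
  by exists y.1; split=> //; right.
case: h => [h1|[a [h1 h3]]].
  by case: xy; case: x y h1 h2 => [? ?] [? ?] /= -> ->.
exists a; split=> //; left; do !split=> //.
by move=> e; apply: xy; case: x y h2 e {h1 h3} => [? ?] [? ?] /= -> ->.
Qed.

(** Four cases, by the types of [y] and [z]. If one of them has second coordinate [x.2], an edge
    forces [v = w], since the first tree has no cycles of length 4 or 6. If neither has, [y.1] and
    [z.1] are both neighbours of [x.1], hence not adjacent by parity, and an edge needs
    [y.2 = z.2]. *)
Lemma link_pgraphE x y z v w : ~~ parity y -> ~~ parity z ->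
  link_middle x y v -> link_middle x z w ->
  pgraph y z <-> link_rel x.2 (v, y.2) (w, z.2).
Proof.
move=> py pz; rewrite /link_rel /=; rewrite /pgraph py pz /=.
have ne (T : rooted_tree) (a b : T) : tadj a b -> b <> a.
  by move/tadjP=> h e; subst; case: h => -[_]; lia.
move=> [xv hy] [xw hz]; split.
- case: hy hz => [[y2 [vy yx]]|[yv xy2]] [[z2 [wz zx]]|[zw xz2]].
  + rewrite y2 z2 => /orP[/andP[_ /ne] //|/andP[_ /siblingsP h]].
    left; split; last by left.
    case: h => [e|[a [h1 h2]]].
      apply: (tadj_middle xv vy xw) => //; last by move/esym.
      by rewrite e.
    case: (y.1 =P z.1) => [e|yz].
      apply: (tadj_middle xv vy xw) => //; last by move/esym.
      by rewrite e.
    apply: (tadj_hexagon xv vy h1 h2 _ _ _ _ yz); rewrite 1?tadjC //.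
      by move/esym.
    by move/esym.
  + move=> h; left; split; last by left.
    case/orP: h => [/andP[h _]|/andP[/eqP e _]]; last first.
      by have := ne _ _ _ xz2; rewrite -e y2.
    subst w; apply: (tadj_middle xv vy xw); first by rewrite tadjC.
    by move/esym.
  + move=> h; left; split; last by right.
    case/orP: h => [/andP[h _]|/andP[/eqP e _]]; last first.
      by have := ne _ _ _ xy2; rewrite e z2.
    subst v; apply: (tadj_middle xv h xw) => //.
    by move/esym.
  + case/orP=> [/andP[h _]|/andP[/eqP e _]].
      subst; have := odd_tadj h; rewrite (odd_tadj xv) (odd_tadj xw).
      by case: odd.
    by right; split=> //; apply: ne xy2.
- case=> [[e]|[e yx]].
    subst w; case: hy hz => [[y2 [vy yx]]|[yv xy2]] [[z2 [wz zx]]|[zw xz2]] h.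
    + apply/orP; right; rewrite y2 z2 eqxx /=.
      by apply: siblings_middle wz; rewrite tadjC.
    + by apply/orP; left; rewrite zw y2 xz2 tadjC vy.
    + by apply/orP; left; rewrite yv z2 wz tadjC xy2.
    + by case: h => h; [have := ne _ _ _ xy2 h|have := ne _ _ _ xz2 h].
  case: hy hz => [[y2 [vy _]]|[yv xy2]] [[z2 [wz _]]|[zw xz2]].
  + by case: yx.
  + by case: yx.
  + by case: yx; rewrite e.
  + subst; apply/orP; right; rewrite e eqxx /=.
    by apply: siblings_middle xw; rewrite tadjC.
Qed.

Lemma link_pgraph_code x : exists code : V -> V, forall y z,
  pgraph x y -> y <> x -> pgraph x z -> z <> x ->
  pgraph y z <-> link_rel x.2 (code y) (code z).
Proof.
have /choice[f Hf] y : exists c, pgraph x y -> y <> x ->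
    c.2 = y.2 /\ link_middle x y c.1.
  have [xy|] := boolP (pgraph x y); last by exists x.
  have [->|/eqP xny] := eqVneq y x; first by exists x.
  by have [|v hv] := link_pgraph xy; [move/esym|exists (v, y.2)].
exists f => y z xy ynx xz znx.
have [fy hy] := Hf y xy ynx; have [fz hz] := Hf z xz znx.
rewrite [f y]surjective_pairing [f z]surjective_pairing fy fz.
by apply: link_pgraphE hy hz; [case/and3P: xy | case/and3P: xz].
Qed.

Variable x : V.

Lemma no_square_link c0 c1 c2 c3 :
  {in [:: c0; c1; c2; c3], forall c, pgraph x c /\ c <> x} ->
  pgraph c0 c1 -> pgraph c1 c2 -> pgraph c2 c3 -> pgraph c3 c0 ->
  ~ pgraph c0 c2 -> ~ pgraph c1 c3 -> False.
Proof.
move=> H; have [f Hf] := link_pgraph_code x.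
have [n0 m0] := H c0 ltac:(rewrite !inE eqxx ?orbT //).
have [n1 m1] := H c1 ltac:(rewrite !inE eqxx ?orbT //).
have [n2 m2] := H c2 ltac:(rewrite !inE eqxx ?orbT //).
have [n3 m3] := H c3 ltac:(rewrite !inE eqxx ?orbT //).
move=> /(Hf _ _ n0 m0 n1 m1) h01 /(Hf _ _ n1 m1 n2 m2) h12.
move=> /(Hf _ _ n2 m2 n3 m3) h23 /(Hf _ _ n3 m3 n0 m0) h30 h02 h13.
apply: (no_square_link_rel h01 h12 h23 h30) => h.
  by apply: h02; apply/Hf.
by apply: h13; apply/Hf.
Qed.

Lemma no_pentagon_link c0 c1 c2 c3 c4 :
  {in [:: c0; c1; c2; c3; c4], forall c, pgraph x c /\ c <> x} ->
  pgraph c0 c1 -> pgraph c1 c2 -> pgraph c2 c3 -> pgraph c3 c4 ->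
  pgraph c4 c0 -> ~ pgraph c0 c2 -> ~ pgraph c0 c3 -> ~ pgraph c1 c3 ->
  ~ pgraph c1 c4 -> ~ pgraph c2 c4 -> False.
Proof.
move=> H; have [f Hf] := link_pgraph_code x.
have [n0 m0] := H c0 ltac:(rewrite !inE eqxx ?orbT //).
have [n1 m1] := H c1 ltac:(rewrite !inE eqxx ?orbT //).
have [n2 m2] := H c2 ltac:(rewrite !inE eqxx ?orbT //).
have [n3 m3] := H c3 ltac:(rewrite !inE eqxx ?orbT //).
have [n4 m4] := H c4 ltac:(rewrite !inE eqxx ?orbT //).
move=> /(Hf _ _ n0 m0 n1 m1) h01 /(Hf _ _ n1 m1 n2 m2) h12.
move=> /(Hf _ _ n2 m2 n3 m3) h23 /(Hf _ _ n3 m3 n4 m4) h34.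
move=> /(Hf _ _ n4 m4 n0 m0) h40 h02 h03 h13 h14 h24.
apply: (no_pentagon_link_rel h01 h12 h23 h34 h40) => h.
- by apply: h02; apply/Hf.
- by apply: h03; apply/Hf.
- by apply: h13; apply/Hf.
- by apply: h14; apply/Hf.
- by apply: h24; apply/Hf.
Qed.

End ProductGraph.

(** * Contraction by successive maps of the vertices *)

Section Collapse.
Variables (V : Type) (E : rel V) (x0 : V).

(** For symmetric [E], the condition on [s] says that a clique and its image together form a clique;
    this is what a straight-line homotopy from the identity to [s] requires. The case [x = y] says
    that [s] moves [x] to a neighbour. *)
Inductive collapsible (P : V -> Prop) : Prop :=
| CollapsePoint of (forall x, P x -> x = x0)
| CollapseStep (Q : V -> Prop) (s : V -> V) of
    (forall x, P x -> Q (s x)) &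
    (forall x y, P x -> P y -> E x y -> E x (s y) /\ E (s x) (s y)) &
    collapsible Q.

Lemma collapsible_sub (P Q : V -> Prop) :
  (forall x, P x -> Q x) -> collapsible Q -> collapsible P.
Proof.
move=> PQ [h|Q' s h1 h2 h3]; first by apply: CollapsePoint => x /PQ /h.
apply: (CollapseStep (s := s) _ _ h3) => [x /PQ /h1 //|x y /PQ Qx /PQ Qy].
exact: h2.
Qed.

Lemma collapsible_chain (P : V -> Prop) : collapsible P ->
  exists (n : nat) (f : nat -> V -> V),
  [/\ forall x, P x -> f 0 x = x, forall x, P x -> f n x = x0 &
      forall k x y, k < n -> P x -> P y -> E x y ->
        [/\ E (f k x) (f k y), E (f k x) (f k.+1 y) &
            E (f k.+1 x) (f k.+1 y)]].
Proof.
elim=> {P} [P h|P Q s h1 h2 _ [n [f [f0 fn fS]]]].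
  by exists 0, (fun=> id); split.
exists n.+1, (fun k => if k is k'.+1 then f k' \o s else id).
split=> [//|x /h1 /fn //|[|k] x y kn Px Py Exy] /=.
  have [? ?] := h2 _ _ Px Py Exy.
  by rewrite !f0; [split|exact: h1|exact: h1].
have [_ Es] := h2 _ _ Px Py Exy.
by apply: fS => //; exact: h1.
Qed.

End Collapse.

(** * Contraction of the product graph *)

Section ProductCollapse.
Variables (T1 T2 : rooted_tree) (r0 : T1).
Hypothesis r0_child : tadj (root T1) r0.
Notation V := (T1 * T2)%type.
Implicit Types x y : V.
Local Notation E := (@pgraph T1 T2).

Section FirstFactor.
Variables (n : nat) (t : T1 -> T1).
Hypothesis n_gt0 : 0 < n.
Hypothesis t_adj : forall v, level v = n -> tadj (parent v) (t v).
Hypothesis t_eq :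
  forall u v, level u = n -> level v = n -> parent u = parent v -> t u = t v.

(** Only the top level [n] moves. The map [t] will be the grandparent for [n >= 2] and the constant
    [r0] for [n = 1]; both preserve parity. *)
Definition shrink1 x : V := if level x.1 == n then (t x.1, x.2) else x.

Lemma parity_shrink1 x : parity (shrink1 x) = parity x.
Proof.
rewrite /shrink1; case: eqP => // xn; rewrite /parity /=.
have := odd_tadj (t_adj xn).
by rewrite !oddD => ->; rewrite level_parent xn; case: n n_gt0.
Qed.

Lemma siblings_top_level (u v : T1) : level u <= n -> level v = n ->
  siblings u v ->
  u = v \/ parent u = parent v /\ level u = n \/ u = parent (parent v) /\ n =
    (level u).+2.
Proof.
move=> un vn /siblingsP[->|[a [/tadjP h1 /tadjP h2]]]; first by left.
by case: h1 h2 => -[? ?] [] [? ?]; subst; try solve [left; congruence];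
  try (exfalso; lia); right; try (by left; split; [congruence|lia]);
  right; split=> //; lia.
Qed.

Lemma shrink1_adj x y : level x.1 <= n -> level y.1 <= n -> E x y ->
  E x (shrink1 y).
Proof.
move=> xn yn Exy; rewrite /shrink1; case: eqP => // ye.
have [px py _] := and3P Exy.
have := parity_shrink1 y; rewrite /shrink1 ye eqxx => pE.
rewrite /pgraph px pE py /=.
case/and3P: Exy => _ _ /orP[/andP[h1 h2]|/andP[-> h]]; apply/orP.
  left; rewrite h2 andbT; case/tadjP: h1 => -[e h]; first by exfalso; lia.
  by rewrite -e; exact: t_adj.
right; case: (siblings_top_level xn ye h) => [->|[[e el]|[e el]]].
- apply: siblings_middle (t_adj ye); apply: tadj_parent; lia.
- apply: siblings_middle (t_adj ye); rewrite -e; apply: tadj_parent; lia.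
- apply: siblings_middle (t_adj ye); rewrite e tadjC; apply: tadj_parent.
  by rewrite level_parent; lia.
Qed.

Lemma shrink1_collapse x y : level x.1 <= n -> level y.1 <= n -> E x y ->
  E x (shrink1 y) /\ E (shrink1 x) (shrink1 y).
Proof.
move=> xn yn Exy; have Exs := shrink1_adj xn yn Exy; split=> //.
case: (level x.1 =P n) => [xe|/eqP xe]; last first.
  by rewrite {1}/shrink1 (negbTE xe).
case: (level y.1 =P n) => [ye|/eqP ye]; last first.
  by rewrite {2}/shrink1 (negbTE ye) pgraphC shrink1_adj // pgraphC.
have [px _ /orP[/andP[/tadjP[] [_ ? ] _]|/andP[/eqP e h]]] := and3P Exy;
  try (exfalso; lia).
(* Adjacent vertices that are both on the top level agree in the second coordinate, and their first
   coordinates have the same parent, so [t_eq] identifies their images. *)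
suff -> : shrink1 y = shrink1 x by rewrite pgraph_refl // parity_shrink1.
rewrite /shrink1 xe ye eqxx e; congr (_, _); apply: t_eq => //.
case: (siblings_top_level xn ye h) => [-> //|[[-> //]|[_ el]]].
by exfalso; lia.
Qed.

End FirstFactor.

Definition bounded n m x := [/\ ~~ parity x, level x.1 <= n & level x.2 <= m].

Definition toggle (v : T1) := if v == root T1 then r0 else root T1.

(** Over a single edge of the first tree, the parity determines the first coordinate from the
    second, so this is a copy of a ball of the second tree. Passing to the parent in the second tree
    must be accompanied by [toggle]. *)
Definition in_edge m x :=
  [/\ ~~ parity x, x.1 = root T1 \/ x.1 = r0 & level x.2 <= m].

Definition shrink2 m x : V :=
  if level x.2 == m then (toggle x.1, parent x.2) else x.

Lemma r0_level : level r0 = 1.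
Proof. by case/tadjP: r0_child => -[_]; rewrite level_root. Qed.

Lemma r0_neq : r0 == root T1 = false.
Proof. by apply/eqP => e; have := r0_level; rewrite e level_root. Qed.

Lemma in_edge_collapsible m : collapsible E (root T1, root T2) (in_edge m).
Proof.
elim: m => [|m IH].
  apply: CollapsePoint => -[u v] [/= h1 h2]; rewrite leqn0 => /eqP v0.
  rewrite (level_eq0 v0); case: h2 h1 => ->; rewrite // /parity /= v0 r0_level.
  by [].
have odd_edge (u : T1) : u = root T1 \/ u = r0 -> odd (level u) = (u == r0).
  by case=> ->; rewrite ?level_root ?r0_level ?eqxx // eq_sym r0_neq.
have toggleP (u : T1) : u = root T1 \/ u = r0 ->
  tadj u (toggle u) /\ (toggle u = root T1 \/ toggle u = r0).
  rewrite /toggle; case=> ->; rewrite ?eqxx ?r0_neq; split; auto.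
  by rewrite tadjC.
have shrink2_adj x y : in_edge m.+1 x -> in_edge m.+1 y -> E x y ->
  E x (shrink2 m.+1 y).
  move=> [px hx xm] [py hy ym] Exy; rewrite /shrink2; case: eqP => // ye.
  have [uu' hu'] := toggleP _ hy.
  have vv' : tadj y.2 (parent y.2) by apply: tadj_parent; rewrite ye.
  have pE : ~~ parity ((toggle y.1, parent y.2) : V).
    move: py; rewrite /parity /= !oddD (odd_tadj uu') (odd_tadj vv').
    by do 2!case: odd.
  case/and3P: Exy => _ _ /orP[/andP[h1 h2]|/andP[/eqP e h]].
    suff -> : (toggle y.1, parent y.2) = x by apply: pgraph_refl.
    have -> : parent y.2 = x.2.
      by case/tadjP: h2 => -[//]; lia.
    suff -> : toggle y.1 = x.1 by case: (x).
    have := odd_tadj h1; rewrite !odd_edge // /toggle.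
    by case: hx hy => -> [] ->; rewrite ?eqxx // ?r0_neq // eq_sym r0_neq.
  have e1 : x.1 = y.1.
    have := odd_siblings h; rewrite !odd_edge //.
    by case: hx hy => -> [] ->; rewrite ?eqxx // eq_sym r0_neq.
  by rewrite /pgraph px pE e1 uu' e vv'.
have shrink2_edge x : in_edge m.+1 x -> in_edge m (shrink2 m.+1 x).
  case=> px hx xm; rewrite /shrink2; case: eqP => xe; last first.
    by split=> //; lia.
  have [uu' hu'] := toggleP _ hx.
  have vv' : tadj x.2 (parent x.2) by apply: tadj_parent; rewrite xe.
  split=> //; last by rewrite level_parent xe.
  move: px; rewrite /parity /= !oddD (odd_tadj uu') (odd_tadj vv').
  by do 2!case: odd.
apply: (CollapseStep shrink2_edge _ IH) => x y hx hy Exy.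
split; first exact: shrink2_adj.
case: (level x.2 =P m.+1) => [xe|/eqP xe]; last first.
  by rewrite {1}/shrink2 (negbTE xe) shrink2_adj.
case: (level y.2 =P m.+1) => [ye|/eqP ye]; last first.
  by rewrite {2}/shrink2 (negbTE ye) pgraphC shrink2_adj // pgraphC.
have [_ _ /orP[/andP[_ /tadjP[] [_ ?]]|/andP[/eqP e h]]] := and3P Exy;
  try (exfalso; lia).
have -> : y = x.
  have [_ hx1 _] := hx; have [_ hy1 _] := hy.
  have := odd_siblings h; rewrite !odd_edge //.
  case: x y hx1 hy1 e {hx hy Exy xe ye h} => [u v] [u' v'] /= + + ->.
  by move=> [] -> [] ->; rewrite ?eqxx // eq_sym r0_neq.
by apply: pgraph_refl; case: (shrink2_edge _ hx).
Qed.

Lemma pgraph_collapsible n m :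
  collapsible E (root T1, root T2) (bounded n m).
Proof.
elim: n => [|n IH].
  apply: collapsible_sub (in_edge_collapsible m) => x [h1 h2 h3]; split=> //.
  by left; apply: level_eq0; lia.
(* On level 1 there is no grandparent: all children of the root are sent to [r0], which leaves the
   edge between the root and [r0]. *)
case: n IH => [_|n IH].
  have h1 : 0 < 1 by [].
  have h2 (v : T1) : level v = 1 -> tadj (parent v) r0.
    by move=> v1; rewrite (@level_eq0 _ (parent v)) // level_parent v1.
  apply: (CollapseStep (s := shrink1 1 (fun=> r0)) _ _ (in_edge_collapsible m)).
    move=> x [px x1 x2]; split.
    - by rewrite parity_shrink1.
    - rewrite /shrink1; case: eqP => e; [by right|left].
      by apply: level_eq0; lia.
    - by rewrite /shrink1; case: eqP.
  by move=> x y [_ x1 _] [_ y1 _]; exact: shrink1_collapse.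
have h2 (v : T1) : level v = n.+2 -> tadj (parent v) (parent (parent v)).
  by move=> v1; apply: tadj_parent; rewrite level_parent v1.
apply: (@CollapseStep _ _ _ _ (bounded n.+1 m) (shrink1 n.+2 (fun v =>
  parent (parent v)))) => //.
  move=> x [px x1 x2]; split.
  - by rewrite parity_shrink1.
  - rewrite /shrink1; case: eqP => e /=; rewrite ?level_parent ?e //; lia.
  - by rewrite /shrink1; case: eqP.
move=> x y [_ x1 _] [_ y1 _]; apply: shrink1_collapse => //.
by move=> u v _ _ /= ->.
Qed.

End ProductCollapse.

(** * Reduced words and automata *)

Section ReducedWords.
Variables (L : finType) (inv : L -> L).
Hypothesis invK : involutive inv.
Implicit Types (l m : L) (s : seq L).

(* A vertex of the tree is a reduced word stored in reverse: the head is the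
   last letter, so that removing the last letter is [behead]. *)
Definition reduced s := sorted (fun l m => l != inv m) s.

Definition rword := {s : seq L | reduced s}.

HB.instance Definition _ := Choice.on rword.

Lemma reduced_behead s : reduced s -> reduced (behead s).
Proof. by case: s => [|l s] //= /path_sorted. Qed.

Definition rw_parent (p : rword) :
  rword := Sub (behead (val p)) (reduced_behead (valP p)).
Definition rw_level (p : rword) := size (val p).
Definition rw_root : rword := Sub [::] isT.
Definition rw_children (p : rword) : seq rword :=
  pmap insub [seq l :: val p | l <- enum L].

Lemma rw_level_parent p : rw_level (rw_parent p) = (rw_level p).-1.
Proof. by rewrite /rw_level size_behead. Qed.

Lemma rw_level_eq0 p : rw_level p = 0 -> p = rw_root.
Proof. by move=> /size0nil p0; apply: val_inj. Qed.

Lemma rw_childrenP p : 0 < rw_level p -> p \in rw_children (rw_parent p).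
Proof.
rewrite /rw_level /rw_children mem_pmap_sub /=.
by case: (val p) => //= l s _; apply: map_f; rewrite mem_enum.
Qed.

Definition rw_tree : rooted_tree :=
  RootedTree rw_level_parent rw_level_eq0 erefl rw_childrenP.

(** Words being stored in reverse, multiplication on the left changes the end of the list, and only
    the last entry can cancel. *)
Fixpoint lmul l s := match s with
  | [::] => [:: l]
  | m :: s' => if s' is [::] then (if m == inv l then [::] else [:: m; l])
               else m :: lmul l s'
  end.

Lemma lmul_cons2 l m n s : lmul l [:: m, n & s] = m :: lmul l (n :: s).
Proof. by []. Qed.

Lemma path_lmul l m n s : reduced (m :: n :: s) ->
  path (fun l m => l != inv m) m (lmul l (n :: s)).
Proof.
elim: s m n => [|k s IH] m n.
  rewrite /= andbT => mn; case: eqP => [//|/eqP nl] /=.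
  by rewrite mn andbT.
by rewrite lmul_cons2 /= => /andP[-> h]; apply: IH.
Qed.

Lemma reduced_lmul l s : reduced s -> reduced (lmul l s).
Proof.
case: s => [|m [|n s]] //; last by rewrite lmul_cons2; apply: path_lmul.
by move=> _ /=; case: eqP => //= /eqP ->.
Qed.

Definition rw_lmul l (p : rword) :
  rword := Sub (lmul l (val p)) (reduced_lmul l (valP p)).

Lemma lmulK l s : reduced s -> lmul (inv l) (lmul l s) = s.
Proof.
elim: s => [|m [|n [|k s]] IH].
- by rewrite /= invK eqxx.
- by move=> _ /=; case: eqP => [-> //|_ /=]; rewrite invK eqxx.
- rewrite /= andbT => mn; case: eqP => [nl|_ /=]; last by rewrite invK eqxx.
  by rewrite /= -nl (negbTE mn).
- by rewrite !lmul_cons2 => /andP[_ h]; have := IH h; rewrite !lmul_cons2 => ->.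
Qed.

Lemma rw_lmulK l : cancel (rw_lmul l) (rw_lmul (inv l)).
Proof. by move=> p; apply: val_inj; rewrite /= lmulK // (valP p). Qed.

Lemma odd_lmul l s : odd (size (lmul l s)) = ~~ odd (size s).
Proof.
elim: s => [|m [|n s] IH] //; first by rewrite /=; case: eqP.
by rewrite lmul_cons2 [size _]/= [LHS]/= IH.
Qed.

(** [parent] acts on the head of the list and [lmul] on its end, so they commute, except on the word
    [inv l]: there the edge to the root is mapped to an edge with the roles of parent and child
    exchanged. *)
Lemma rw_lmul_adj_parent l (p : rw_tree) : 0 < level p ->
  @tadj rw_tree (rw_lmul l p) (rw_lmul l (parent p)).
Proof.
case: p => -[//|m [|n s]] hs _.
  rewrite /tadj /=; case: (eqVneq m (inv l)) => [ml|ml].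
    apply/orP; right; rewrite andbT; apply/eqP; apply: val_inj => /=.
    by rewrite ml eqxx.
  apply/orP; left; apply/andP; split.
    by apply/eqP; apply: val_inj; rewrite /= (negbTE ml).
  by rewrite /rw_level /= (negbTE ml).
apply/orP; left; apply/andP; split=> //.
by apply/eqP; apply: val_inj.
Qed.

Lemma rw_lmul_adj l (p q : rw_tree) : tadj p q ->
  @tadj rw_tree (rw_lmul l p) (rw_lmul l q).
Proof.
by case/orP=> /andP[/eqP <- h]; [|rewrite tadjC]; apply: rw_lmul_adj_parent.
Qed.

End ReducedWords.

(* [out a x] and [next a x] are the letters [x'] and [a'] of the relation
   [a x = x' a']. *)
Section Automaton.
Variables (A L : finType) (invA : A -> A) (inv : L -> L).
Variables (out : A -> L -> L) (next : A -> L -> A).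
Hypothesis invK : involutive inv.
Hypothesis out_inv : forall a x, out (invA a) (out a x) = x.
Hypothesis next_inv : forall a x, next (invA a) (out a x) = invA (next a x).
Hypothesis out_invl : forall a x, out (next a x) (inv x) = inv (out a x).
Hypothesis next_invl : forall a x, next (next a x) (inv x) = a.
Implicit Types (a b : A) (x : L) (s : seq L).

(** The pair [(s', a')] with [a s = s' a']. Reading starts at the end of the list, where the first
    letter of the word is. *)
Fixpoint run a s : seq L * A := match s with
  | [::] => ([::], a)
  | x :: s' => (out (run a s').2 x :: (run a s').1, next (run a s').2 x)
  end.

Lemma size_run a s : size (run a s).1 = size s.
Proof. by elim: s => //= x s ->. Qed.

Lemma out_inj a : injective (out a).
Proof. by move=> x y h; rewrite -[x](out_inv a) h out_inv. Qed.

Lemma reduced_run a s : reduced inv s -> reduced inv (run a s).1.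
Proof.
elim: s => [//|x [//|y s] IH] /andP[xy h]; have /= := IH h => ->.
rewrite andbT.
rewrite -out_invl; apply: contra_neq xy => /out_inj ->.
by rewrite ?invK.
Qed.

(** When [x] cancels against [inv x], a state that passes through both is unchanged, and the two
    outputs cancel as well. *)
Lemma run_lmul a x s : run a (lmul inv x s) =
  (lmul inv (out a x) (run (next a x) s).1, (run (next a x) s).2).
Proof.
elim: s => [|m [|n s] IH] //.
  rewrite /=; case: (eqVneq m (inv x)) => [->|mx] /=.
    by rewrite out_invl eqxx next_invl.
  by rewrite -out_invl (inj_eq (@out_inj _)) (negbTE mx).
rewrite lmul_cons2 [LHS]/= -/(lmul _ _ (n :: s)) IH.
by rewrite -/(run _ (n :: s)).
Qed.

Lemma runK a s : run (invA a) (run a s).1 = (s, invA (run a s).2).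
Proof. by elim: s => //= x s ->; rewrite /= out_inv next_inv. Qed.

Definition rw_run a (p : rword inv) : rword inv :=
  Sub (run a (val p)).1 (reduced_run a (valP p)).

Lemma rw_runK a : cancel (rw_run a) (rw_run (invA a)).
Proof. by move=> p; apply: val_inj; rewrite /= runK. Qed.

Lemma rw_run_lmul a x p :
  rw_run a (rw_lmul x p) = rw_lmul (out a x) (rw_run (next a x) p).
Proof. by apply: val_inj; rewrite /= run_lmul. Qed.

Lemma rw_run_adj a (p q : rw_tree inv) :
  tadj p q -> @tadj (rw_tree inv) (rw_run a p) (rw_run a q).
Proof.
have key (u : rw_tree inv) : 0 < level u ->
    @tadj (rw_tree inv) (rw_run a u) (rw_run a (parent u)).
  case: u => -[//|m s] hs _; apply/orP; left; apply/andP; split=> //.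
  by apply/eqP; apply: val_inj.
by case/orP=> /andP[/eqP <- h]; [|rewrite tadjC]; apply: key.
Qed.

End Automaton.

(** * The group *)

(* The automaton is the Bellaterra automaton. Its states are involutions
   [a = Some false], [b = Some true], [c = None]; a letter [(y, neg, k)] is
   [x_k] or [y_k] (according to [y]), inverted if [neg]. The relations are
     [a x = x c], [a y = y b], [b x = x b], [b y = y c], [c x = y a], [c y = x a]
   for each of the two copies [k] of the alphabet; [out] and [next] also list
   their consequences for the inverse letters. *)
Definition state : finType := option bool.
Definition letter : finType := (bool * bool * bool)%type.

Definition flips (a : state) neg :=
  if neg then a == Some false else a == None.

Definition next_state (a : state) (y neg : bool) : state :=
  match a with
  | Some false => if neg then None else if y then Some true else None
  | Some true => if neg then (if y then Some false else Some true)
                 else if y then None else Some true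
  | None => if neg then (if y then Some true else Some false) else Some false
  end.

Definition linv (x : letter) : letter := let: (y, neg, k) := x in (y, ~~ neg,
  k).

Definition out (a : state) (x : letter) : letter :=
  let: (y, neg, k) := x in (y (+) flips a neg, neg, k).
Definition next (a : state) (x : letter) : state :=
  let: (y, neg, k) := x in next_state a y neg.

(** The dual automaton: the relations [a x = x' a'] read from right to left, with
    [dual_out x' a' = a] and [dual_next x' a' = x]. *)
Definition dual_flips (a : state) (neg : bool) :=
  if neg then a == None else a == Some false.

Definition dual_state (a : state) (y neg : bool) : state :=
  match a with
  | Some false => if neg then (if y then Some true else None) else None
  | Some true => if neg then (if y then None else Some true)
                 else if y then Some false else Some true
  | None => if neg then Some false else if y then Some true else Some false
  end.

Definition dual_out (x : letter) (a : state) : state :=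
  let: (y, neg, k) := x in dual_state a y neg.
Definition dual_next (x : letter) (a : state) : letter :=
  let: (y, neg, k) := x in (y (+) dual_flips a neg, neg, k).

Lemma linvK : involutive linv. Proof. by case=> [[[] []] []]. Qed.
Lemma out_inv a x : out (id a) (out a x) = x.
Proof. by case: a x => [[]|] [[[] []] []]. Qed.
Lemma next_inv a x : next (id a) (out a x) = id (next a x).
Proof. by case: a x => [[]|] [[[] []] []]. Qed.
Lemma out_invl a x : out (next a x) (linv x) = linv (out a x).
Proof. by case: a x => [[]|] [[[] []] []]. Qed.
Lemma next_invl a x : next (next a x) (linv x) = a.
Proof. by case: a x => [[]|] [[[] []] []]. Qed.
Lemma dual_out_inv x a : dual_out (linv x) (dual_out x a) = a.
Proof. by case: a x => [[]|] [[[] []] []]. Qed.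
Lemma dual_next_inv x a :
  dual_next (linv x) (dual_out x a) = linv (dual_next x a).
Proof. by case: a x => [[]|] [[[] []] []]. Qed.
Lemma dual_out_invl x a : dual_out (dual_next x a) (id a) = id (dual_out x a).
Proof. by case: a x => [[]|] [[[] []] []]. Qed.
Lemma dual_next_invl x a : dual_next (dual_next x a) (id a) = x.
Proof. by case: a x => [[]|] [[[] []] []]. Qed.
Lemma dual_outK a x : dual_out (out a x) (next a x) = a.
Proof. by case: a x => [[]|] [[[] []] []]. Qed.
Lemma dual_nextK a x : dual_next (out a x) (next a x) = x.
Proof. by case: a x => [[]|] [[[] []] []]. Qed.
Lemma out_dualK a x : out (dual_out x a) (dual_next x a) = x.
Proof. by case: a x => [[]|] [[[] []] []]. Qed.
Lemma next_dualK a x : next (dual_out x a) (dual_next x a) = a.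
Proof. by case: a x => [[]|] [[[] []] []]. Qed.

Definition state_invK : involutive (@id state) := fun=> erefl.

Definition stateTree := @rw_tree state id.
Definition letterTree := @rw_tree letter linv.

Definition vertex : choiceType := (stateTree * letterTree)%type.
Definition gen := (state + letter)%type.

Local Notation ginl := (inl : state -> gen).
Local Notation ginr := (inr : letter -> gen).

(** An element [g = p x = q a], with [p], [a] words in the states and [x], [q] words in the letters,
    corresponds to the vertex [(p, q)]. This is left multiplication in these coordinates. *)
Definition act (m : gen) (v : vertex) : vertex :=
  match m with
  | inl a => (@rw_lmul state id a v.1,
              @rw_run state letter id linv out next out_inv out_invl a v.2)
  | inr x => (@rw_run letter state linv id dual_out dual_next
                dual_out_inv dual_out_invl x v.1,
              @rw_lmul letter linv x v.2)
  end.

Definition gen_inv (m : gen) : gen :=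
  match m with inl a => inl a | inr x => inr (linv x) end.

Lemma gen_invK : involutive gen_inv.
Proof. by case=> [a|x] //=; rewrite linvK. Qed.

Lemma actK m : cancel (act m) (act (gen_inv m)).
Proof.
case: m => [a|x] [p q] /=; congr (_, _).
- exact: (rw_lmulK state_invK).
- exact: (rw_runK out_inv next_inv out_invl).
- exact: (rw_runK dual_out_inv dual_next_inv dual_out_invl).
- exact: (rw_lmulK linvK).
Qed.

Lemma act_relation a x v :
  act (inl a) (act (inr x) v) = act (inr (out a x)) (act (inl (next a x)) v).
Proof.
case: v => p q /=; congr (_, _); last exact: rw_run_lmul next_invl _ _ _.
rewrite (rw_run_lmul dual_out_inv dual_out_invl dual_next_invl).
by rewrite dual_outK dual_nextK.
Qed.

Lemma act_adj1 m (v w : vertex) : tadj (act m v).1 (act m w).1 = tadj v.1 w.1.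
Proof.
have key m' (v' w' : vertex) : tadj v'.1 w'.1 ->
  tadj (act m' v').1 (act m' w').1.
  by case: m' => [a|x] h /=; [apply: rw_lmul_adj|apply: rw_run_adj].
by apply/idP/idP => [/(key (gen_inv m))|/key//]; rewrite !actK.
Qed.

Lemma act_adj2 m (v w : vertex) : tadj (act m v).2 (act m w).2 = tadj v.2 w.2.
Proof.
have key m' (v' w' : vertex) : tadj v'.2 w'.2 ->
  tadj (act m' v').2 (act m' w').2.
  by case: m' => [a|x] h /=; [apply: rw_run_adj|apply: rw_lmul_adj].
by apply/idP/idP => [/(key (gen_inv m))|/key//]; rewrite !actK.
Qed.

Lemma parity_act m (v : vertex) : parity (act m v) = ~~ parity v.
Proof.
case: m => [a|x]; rewrite /parity !oddD /= /rw_level /= size_run odd_lmul;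
  by do 2!case: odd.
Qed.

Definition actw (w : seq gen) (v : vertex) : vertex := foldr act v w.

Lemma actw_cat w1 w2 v : actw (w1 ++ w2) v = actw w1 (actw w2 v).
Proof. by rewrite /actw foldr_cat. Qed.

Lemma parity_actw w v : parity (actw w v) = odd (size w) (+) parity v.
Proof. by elim: w => //= m w IH; rewrite parity_act IH addNb. Qed.

Definition winv (w : seq gen) := rev (map gen_inv w).

Lemma winv_cons m w : winv (m :: w) = rcons (winv w) (gen_inv m).
Proof. by rewrite /winv /= rev_cons. Qed.

Lemma size_winv w : size (winv w) = size w.
Proof. by rewrite size_rev size_map. Qed.

Lemma winv_cat w1 w2 : winv (w1 ++ w2) = winv w2 ++ winv w1.
Proof. by rewrite /winv map_cat rev_cat. Qed.

Lemma winvK : involutive winv.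
Proof. by move=> w; rewrite /winv map_rev revK mapK //; exact: gen_invK. Qed.

Lemma actwK w : cancel (actw w) (actw (winv w)).
Proof.
move=> v; elim: w => //= m w IH.
by rewrite winv_cons -cats1 actw_cat /= actK.
Qed.

Lemma actwKV w : cancel (actw (winv w)) (actw w).
Proof. by move=> v; rewrite -{1}[w]winvK actwK. Qed.

Lemma actw_adj1 w (v v' : vertex) :
  tadj (actw w v).1 (actw w v').1 = tadj v.1 v'.1.
Proof. by elim: w => //= m w <-; rewrite act_adj1. Qed.

Lemma actw_adj2 w (v v' : vertex) :
  tadj (actw w v).2 (actw w v').2 = tadj v.2 v'.2.
Proof. by elim: w => //= m w <-; rewrite act_adj2. Qed.

Lemma act_fst m (v v' : vertex) : v.1 = v'.1 -> (act m v).1 = (act m v').1.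
Proof. by case: m => [a|x] /= ->. Qed.
Lemma act_snd m (v v' : vertex) : v.2 = v'.2 -> (act m v).2 = (act m v').2.
Proof. by case: m => [a|x] /= ->. Qed.
Arguments act : simpl never.

Lemma actw_fst w (v v' : vertex) : v.1 = v'.1 -> (actw w v).1 = (actw w v').1.
Proof. by elim: w => //= m w IH /IH; exact: act_fst. Qed.
Lemma actw_snd w (v v' : vertex) : v.2 = v'.2 -> (actw w v).2 = (actw w v').2.
Proof. by elim: w => //= m w IH /IH; exact: act_snd. Qed.

(** * Normal forms and simple transitivity *)

Definition base : vertex := (root stateTree, root letterTree).

Definition weq w1 w2 := forall v, actw w1 v = actw w2 v.

Lemma letter_through_states x (w : seq state) : exists w' x',
  weq (inr x :: map ginl w) (rcons (map ginl w') (inr x')).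
Proof.
elim: w x => [|a w IH] x; first by exists [::], x.
have [w' [x' h]] := IH (dual_next x a).
exists (dual_out x a :: w'), x' => v /=.
by rewrite -h /= act_relation out_dualK next_dualK.
Qed.

Lemma normal_form w : exists (s : seq state) (t : seq letter),
  weq w (map ginl s ++ map ginr t).
Proof.
elim: w => [|[a|x] w [s [t h]]]; first by exists [::], [::].
  by exists (a :: s), t => v /=; rewrite h.
have [s' [x' h']] := letter_through_states x s.
exists s', (x' :: t) => v /=; rewrite h !actw_cat.
by have := h' (actw (map ginr t) v); rewrite /= => ->; rewrite -cats1 actw_cat.
Qed.

Lemma actw_rcons w m v : actw (rcons w m) v = actw w (act m v).
Proof. by rewrite -cats1 actw_cat. Qed.

Lemma actw_lmul (K : finType) (inv : K -> K) (i : K -> gen) l s v :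
  (forall k, i (inv k) = gen_inv (i k)) ->
  actw (rev (map i (lmul inv l s))) v = act (i l) (actw (rev (map i s)) v).
Proof.
move=> iV; elim: s v => [|m [|n s] IH] v //.
  rewrite [lmul _ _ _]/=; case: eqP => [->|_] //.
  transitivity (act (i l) (act (i (inv l)) v)); last by [].
  by rewrite iV -{1}[i l]gen_invK actK.
rewrite lmul_cons2 map_cons rev_cons actw_rcons IH.
by rewrite [in RHS]map_cons [in RHS]rev_cons actw_rcons.
Qed.

Definition state_word (p : stateTree) : seq gen := rev (map ginl (val p)).
Definition letter_word (p : letterTree) : seq gen := rev (map ginr (val p)).

(** Both sides undergo the same left multiplications. Hence the image of the base point determines
    the whole action of a word in the states. *)
Lemma map_inl_weq (s : seq state) :
  weq (map ginl s) (state_word (actw (map ginl s) base).1).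
Proof.
elim: s => //= a s IH v.
by rewrite [actw _ v]/= IH /state_word /= (actw_lmul (inv := id)).
Qed.

Lemma map_inr_weq (t : seq letter) :
  weq (map ginr t) (letter_word (actw (map ginr t) base).2).
Proof.
elim: t => //= a s IH v.
by rewrite [actw _ v]/= IH /letter_word /= (actw_lmul (inv := linv)).
Qed.

Lemma actw_inr_root (t : seq letter) v :
  v.1 = root stateTree -> (actw (map ginr t) v).1 = root stateTree.
Proof. by move=> v0; elim: t => //= x t IH; rewrite /act IH;
  apply: val_inj. Qed.

Lemma lmul_rcons (K : finType) (inv : K ->
  K) l s : reduced inv (rcons s l) -> lmul inv l s = rcons s l.
Proof.
elim: s => [|m [|n s] IH] //; first by rewrite /= andbT => /negbTE ->.
by rewrite lmul_cons2 => /andP[_ h]; rewrite IH.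
Qed.

Lemma val_state_word s (v : vertex) : reduced id (val v.1 ++ s) ->
  val (actw (rev (map ginl s)) v).1 = val v.1 ++ s.
Proof.
elim: s v => [|a s IH] v; first by rewrite cats0.
rewrite map_cons rev_cons actw_rcons -cat_rcons => h.
have e : val (act (inl a) v).1 = rcons (val v.1) a.
  by rewrite /act /= lmul_rcons //; exact: (cat_sorted2 h).1.
by rewrite IH e.
Qed.

Lemma val_letter_word s (v : vertex) : reduced linv (val v.2 ++ s) ->
  val (actw (rev (map ginr s)) v).2 = val v.2 ++ s.
Proof.
elim: s v => [|a s IH] v; first by rewrite cats0.
rewrite map_cons rev_cons actw_rcons -cat_rcons => h.
have e : val (act (inr a) v).2 = rcons (val v.2) a.
  by rewrite /act /= lmul_rcons //; exact: (cat_sorted2 h).1.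
by rewrite IH e.
Qed.

Lemma actw_transitive (v : vertex) : exists w, actw w base = v.
Proof.
case: v => p q.
have e1 u : u.1 = root stateTree -> (actw (state_word p) u).1 = p.
  move=> u0; apply: val_inj; rewrite val_state_word ?u0 //.
  exact: (valP p).
(* [state_word p], applied last, also moves the second coordinate, so the letters have to produce
   the preimage of [q]. *)
pose q' := (actw (winv (state_word p)) (p, q)).2.
exists (state_word p ++ letter_word q'); rewrite actw_cat.
have e2 : actw (letter_word q') base = (root stateTree, q').
  apply: injective_projections.
    by rewrite /letter_word -map_rev actw_inr_root.
  by apply: val_inj; rewrite /= val_letter_word //; exact: (valP q').
rewrite e2; apply: injective_projections; first by rewrite e1.
rewrite /= -[q in RHS]/((p, q).2).
rewrite -[in RHS](actwKV (state_word p) (p, q)).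
exact: actw_snd.
Qed.

(** At the base point: letters fix the root of the first tree, so the first coordinate determines
    the state part of a normal form; once this is cancelled, the second coordinate determines the
    letter part. Transitivity gives the other vertices. *)
Lemma actw_free w1 w2 v : actw w1 v = actw w2 v -> weq w1 w2.
Proof.
have key u1 u2 : actw u1 base = actw u2 base -> weq u1 u2.
  have [s1 [t1 h1]] := normal_form u1; have [s2 [t2 h2]] := normal_form u2.
  rewrite h1 h2 !actw_cat => e.
  have es : weq (map ginl s1) (map ginl s2).
    move=> u; rewrite map_inl_weq [RHS]map_inl_weq;
      congr (actw (state_word _) _).
    have h (s : seq state) (t : seq letter) :
        (actw (map ginl s) base).1 = (actw (map ginl s) (actw (map ginr t)
          base)).1.
      by apply: actw_fst; rewrite actw_inr_root.
    by rewrite (h _ t1) (h _ t2) e.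
  have {}e : actw (map ginr t1) base = actw (map ginr t2) base.
    by apply: (can_inj (actwK (map ginl s1))); rewrite e es.
  move=> u; rewrite h1 h2 !actw_cat es; congr actw.
  by rewrite map_inr_weq [RHS]map_inr_weq e.
have [w <-] := actw_transitive v.
rewrite -!actw_cat => /key h u.
by have := h (actw (winv w) u); rewrite !actw_cat !actwKV.
Qed.

(* Words of odd length exchange the two classes of vertices of the product of
   trees, only one of which carries the systolic complex. *)
Definition is_even_word (g : vertex -> vertex) : bool :=
  `[< exists w, ~~ odd (size w) /\ g = actw w >].

Definition even_group := {g : vertex -> vertex | is_even_word g}.

HB.instance Definition _ := Choice.on even_group.

Lemma even_wordP (g : even_group) : exists w, ~~ odd (size w) /\ val g = actw w.
Proof. exact/asboolP/(valP g). Qed.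

Lemma even_oneP : is_even_word id.
Proof. by apply/asboolP; exists [::]. Qed.

Lemma even_mulP (g h : even_group) : is_even_word (val g \o val h).
Proof.
apply/asboolP; have [w [w0 ->]] := even_wordP g;
  have [u [u0 ->]] := even_wordP h.
exists (w ++ u); rewrite size_cat oddD (negbTE w0) (negbTE u0); split=> //.
by apply/funext => v; rewrite actw_cat.
Qed.

Definition even_word (g : even_group) : seq gen := sval (cid (even_wordP g)).

Lemma even_word_even g : ~~ odd (size (even_word g)).
Proof. by rewrite /even_word; case: cid => w []. Qed.

Lemma even_wordE g : val g = actw (even_word g).
Proof. by rewrite /even_word; case: cid => w []. Qed.

Lemma even_invP g : is_even_word (actw (winv (even_word g))).
Proof. by apply/asboolP; exists (winv (even_word g));
  rewrite size_winv even_word_even. Qed.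

Definition even_one : even_group := Sub id even_oneP.
Definition even_mul (g h : even_group) : even_group :=
  Sub (val g \o val h) (even_mulP g h).
Definition even_inv (g : even_group) : even_group := Sub _ (even_invP g).

Lemma even_mulA : associative even_mul.
Proof. by move=> g h k; apply: val_inj. Qed.
Lemma even_mul1g : left_id even_one even_mul.
Proof. by move=> g; apply: val_inj. Qed.
Lemma even_mulg1 : right_id even_one even_mul.
Proof. by move=> g; apply: val_inj. Qed.
Lemma even_mulVg : left_inverse even_one even_inv even_mul.
Proof. by move=> g; apply: val_inj; apply/funext => v;
  rewrite /= even_wordE actwK. Qed.
Lemma even_mulgV : right_inverse even_one even_inv even_mul.
Proof. by move=> g; apply: val_inj; apply/funext => v;
  rewrite /= even_wordE actwKV. Qed.

HB.instance Definition _ := isGroup.Build even_group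
  even_mulA even_mul1g even_mulg1 even_mulVg even_mulgV.

Definition even_elt (w : seq gen) : even_group := insubd even_one (actw w).

Lemma val_even_elt w : ~~ odd (size w) -> val (even_elt w) = actw w.
Proof.
by move=> w0; rewrite val_insubd ifT //; apply/asboolP; exists w.
Qed.

(** * Failure of residual finiteness *)

Definition read (w : seq state) (y : bool) : bool * seq state :=
  foldr (fun a r => (r.1 (+) flips a false, next_state a r.1 false :: r.2))
    (y, [::]) w.

Definition pos (k y : bool) : gen := inr (y, false, k).

(** A positive letter stays positive and in its copy [k], and the resulting word in the states does
    not depend on [k]: the two copies cannot be told apart by the states. *)
Lemma actw_read k w y v : actw (map ginl w) (act (pos k y) v) =
  act (pos k (read w y).1) (actw (map ginl (read w y).2) v).
Proof. by elim: w => //= a w ->; rewrite act_relation. Qed.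

Local Notation nC := (count (fun a : state => a == None)).

Lemma size_read w y : size (read w y).2 = size w.
Proof. by elim: w => //= a w ->. Qed.

Lemma read_fst w y : (read w y).1 = y (+) odd (nC w).
Proof.
elim: w => [|a w IH] /=; first by rewrite addbF.
by rewrite IH oddD -addbA [_ (+) odd (nC w)]addbC /flips; case: (a == None).
Qed.

(** For every state, exactly one among itself and its sections at [x] and at [y] is [c]; the two
    readings of [w] meet each state with opposite letters. *)
Lemma count_read w y :
  nC (read w y).2 + nC (read w (~~ y)).2 + nC w = size w.
Proof.
elim: w => //= a w <-; rewrite !read_fst addNb.
by case: a => [[]|]; case: (y (+) _) => /=; lia.
Qed.

(* The two halves of [w w] read opposite letters, because [w] exchanges [x] and
   [y]; so each generator of [w] contributes both of its sections. *)
Lemma actw_square w y : odd (nC w) -> exists w',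
  [/\ forall k v, actw (map ginl (w ++ w)) (act (pos k y) v) =
        act (pos k y) (actw (map ginl w') v),
      size w' = (size w).*2 & nC w' + nC w = size w].
Proof.
move=> w0; exists ((read w (~~ y)).2 ++ (read w y).2).
have e z : (read w z).1 = ~~ z by rewrite read_fst w0 addbT.
split; last by rewrite count_cat -(count_read w y); lia.
  move=> k v; rewrite !map_cat !actw_cat actw_read e actw_read e negbK //.
by rewrite size_cat !size_read addnn.
Qed.

Definition wpow (T : Type) (w : seq T) n := flatten (nseq n w).

Lemma wpowS (T : Type) (w : seq T) n : wpow w n.+1 = w ++ wpow w n.
Proof. by []. Qed.

Lemma wpow_double (T : Type) (w : seq T) n : wpow w n.*2 = wpow (w ++ w) n.
Proof. by elim: n => // n IH; rewrite doubleS !wpowS IH catA. Qed.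

Lemma size_wpow (T : Type) (w : seq T) n : size (wpow w n) = size w * n.
Proof. by rewrite /wpow size_flatten /shape map_nseq sumn_nseq. Qed.

Lemma map_wpow (T T' : Type) (f : T ->
  T') w n : map f (wpow w n) = wpow (map f w) n.
Proof. by rewrite /wpow map_flatten map_nseq. Qed.

(** For odd [n], the power itself works. A factor 2 of [n] is absorbed by conjugating [w w] with
    [x_0] into [w'], which satisfies the hypotheses again: its number of [c] is [size w - nC w], an
    odd number. *)
Lemma swapping_conjugate n (w : seq state) : 0 < n ->
  odd (nC w) -> ~~ odd (size w) ->
  exists (u : seq gen) (v : seq state), [/\ odd (nC v), ~~ odd (size v) &
    weq (map ginl (wpow w n) ++ u) (u ++ map ginl v)].
Proof.
have [m] := ubnP n; elim: m n w => // m IH n w nm n0 cw sw.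
have [no|ne] := boolP (odd n).
  exists [::], (wpow w n); split; last by rewrite cats0.
    by rewrite /wpow count_flatten map_nseq sumn_nseq oddM cw.
  by rewrite size_wpow oddM (negbTE sw).
have [w' [hw' sw' cw']] := actw_square false cw.
have nE : n = n./2.*2 by rewrite even_halfK.
have [||||u [v [cv sv h]]] := IH n./2 w'; try lia.
exists (pos false false :: u), v; split=> // z.
have key j z' : actw (map ginl (wpow w j.*2)) (act (pos false false) z') =
    act (pos false false) (actw (map ginl (wpow w' j)) z').
  elim: j => // j IHj; rewrite wpow_double !wpowS. rewrite map_cat (actw_cat
    (map ginl (w ++ w))). 
  by rewrite -wpow_double IHj hw' map_cat actw_cat.
rewrite [X in wpow w X]nE actw_cat.
rewrite -[LHS]/(actw _ (act (pos false false) (actw u z))) key.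
rewrite -[RHS]/(act (pos false false) (actw (u ++ map ginl v) z)).
by have := h z; rewrite !actw_cat => ->.
Qed.

Section NotResiduallyFinite.
Variables (F : finGroupType) (f : even_group -> F).
Hypothesis fM : {morph f : g h / (g * h)%g}.

Lemma even_elt_cat w1 w2 : ~~ odd (size w1) -> ~~ odd (size w2) ->
  even_elt (w1 ++ w2) = (even_elt w1 * even_elt w2)%g.
Proof.
move=> h1 h2; apply: val_inj; rewrite /= !val_even_elt //.
  by apply/funext => v; rewrite actw_cat.
by rewrite size_cat oddD (negbTE h1) (negbTE h2).
Qed.

Lemma even_elt_weq w1 w2 : weq w1 w2 -> even_elt w1 = even_elt w2.
Proof. by move=> h; rewrite /even_elt; congr insubd; apply/funext. Qed.

Lemma morph_one : f 1%g = 1%g.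
Proof.
by apply: (mulgI (f 1%g)); rewrite -fM !mulg1.
Qed.

(** [u] may have odd length and thus lie outside the domain of [f], so the conjugate of [w] is
    treated as a single element [c] of the even group. *)
Lemma morph_conj_pow w u : ~~ odd (size w) ->
  f (even_elt (winv u ++ wpow w #|F| ++ u)) = 1%g.
Proof.
move=> sw; pose c := winv u ++ w ++ u.
have sc k : ~~ odd (size (winv u ++ wpow w k ++ u)).
  by rewrite !size_cat size_winv size_wpow !oddD oddM (negbTE sw) addbb.
have key k : f (even_elt (winv u ++ wpow w k ++ u)) = (f (even_elt c) ^+ k)%g.
  elim: k => [|k IH].
    have -> : even_elt (winv u ++ wpow w 0 ++ u) = 1%g.
      apply: val_inj; rewrite val_even_elt //.
      by apply/funext => v; rewrite actw_cat actwK.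
    by rewrite morph_one.
  rewrite expgS -IH -fM -even_elt_cat //; last first.
    by have := sc 1; rewrite wpowS /= cats0.
  congr f; apply: even_elt_weq => v.
  by rewrite wpowS !actw_cat actwKV.
by rewrite key -cardsT expg_cardG ?inE.
Qed.

Definition swap_elt k : even_group := even_elt [:: gen_inv (pos k true);
  pos k false].

Lemma morph_swap : f (swap_elt false) = f (swap_elt true).
Proof.
pose w : seq state := [:: None; Some false].
have F0 : 0 < #|F| by rewrite -cardsT cardG_gt0.
have [u [v [cv sv h]]] := @swapping_conjugate #|F| w F0 isT isT.
pose v' := (read v false).2.
have sv' : ~~ odd (size (map ginl v' : seq gen)) by rewrite size_map size_read.
suff key k : f (swap_elt k) = f (even_elt (map ginl v')) by rewrite !key.
(* The conjugated power is [x_k^-1 v x_k = x_k^-1 y_k v'], so multiplying it by [y_k^-1 x_k] on the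
   left gives [v']; and [f] kills the conjugated power. *)
have -> : even_elt (map ginl v') =
    (swap_elt k * even_elt (winv (u ++ [:: pos k false]) ++
       wpow (map ginl w) #|F| ++ u ++ [:: pos k false]))%g.
  rewrite -even_elt_cat //; last first.
    rewrite !size_cat size_winv size_cat size_wpow addnCA addnn.
    by rewrite oddD odd_double addbF oddM size_map.
  apply: even_elt_weq => z.
  rewrite !actw_cat -map_wpow.
  have := h (act (pos k false) z); rewrite !actw_cat /= => ->.
rewrite winv_cat actw_cat actwK (actw_read k v false z).
  rewrite -[actw (winv _) _]/(act (gen_inv (pos k false)) _).
  rewrite -{1}[pos k false]gen_invK actK read_fst cv.
  by rewrite (actK (pos k true)).
by rewrite fM morph_conj_pow // mulg1.
Qed.

End NotResiduallyFinite.

Lemma swap_elt_neq : swap_elt false <> swap_elt true.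
Proof.
move=> /(congr1 val);
  rewrite !val_even_elt // => /(congr1 (fun g => (g base).2)).
by move/(congr1 val).
Qed.

Lemma even_group_not_residually_finite : exists2 g : even_group, g <> 1%g &
  forall (F : finGroupType) (f : {multiplicative even_group -> F}), f g = 1%g.
Proof.
exists ((swap_elt false)^-1 * swap_elt true)%g.
  by move=> h; apply: swap_elt_neq;
    rewrite -[RHS](mulKVg (swap_elt false)) h mulg1.
move=> F f; have fM : {morph f : g h / (g * h)%g} by move=> g h; rewrite gmulfM.
rewrite fM -(morph_swap fM) -fM mulVg; exact: morph_one.
Qed.

(** * Clique complexes and their links *)

Local Open Scope classical_set_scope.
Local Open Scope fset_scope.

Section CliqueComplex.
Variables (V : choiceType) (E : rel V).

(** Pairs with [x = y] are included, so only the [x] with [E x x] are vertices of the complex. *)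
Definition is_clique (s : {fset V}) :=
  (s != fset0) && [forall x : s, forall y : s, E (val x) (val y)].

Lemma is_cliqueP (s : {fset V}) :
  reflect (s <> fset0 /\ {in s &, forall x y, E x y}) (is_clique s).
Proof.
apply: (iffP andP) => [[/eqP s0 h]|[/eqP s0 h]]; split=> //.
  move=> x y xs ys; move/forallP: h => /(_ [` xs]) /forallP /(_ [` ys]).
  by [].
apply/forallP => x; apply/forallP => y; apply: h; exact: valP.
Qed.

Definition csimplex := {s : {fset V} | is_clique s}.

HB.instance Definition _ := Choice.on csimplex.

Definition cvert (s : csimplex) : finType := val s.

Definition cattach (s t : csimplex) : set (cvert s -> cvert t) :=
  [set f | (forall x, val (f x) = val x :> V) /\ s <> t].

Lemma cvert_gt0 s : (0 < #|cvert s|)%N.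
Proof.
have /is_cliqueP[s0 _] := valP s.
by rewrite /cvert /= -cardfE cardfs_gt0; apply/eqP.
Qed.

Lemma cattach_inj s t (f : cvert s -> cvert t) : cattach f -> injective f.
Proof.
by move=> [fE _] x y /(congr1 val); rewrite !fE => /val_inj.
Qed.

Lemma cattach_sub s t (f : cvert s -> cvert t) : cattach f -> val s `<=` val t.
Proof.
move=> [fE _]; apply/fsubsetP => x xs.
by have := fE [` xs] => /= <-; exact: valP.
Qed.

Lemma cattach_proper s t (f : cvert s -> cvert t) :
  cattach f -> range f <> setT.
Proof.
move=> af fT; have [fE] := af; apply; apply: val_inj; apply/eqP.
rewrite eqEfsubset (cattach_sub af); apply/fsubsetP => x xt.
have [y _ yx] : range f [` xt] by rewrite fT.
by rewrite -[x]/(val [` xt]) -yx fE; exact: valP.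
Qed.

Lemma cattach_comp s t u (f : cvert s -> cvert t) (g : cvert t -> cvert u) :
  cattach f -> cattach g -> cattach (g \o f).
Proof.
move=> af ag; have [fE st] := af; have [gE tu] := ag.
split=> [x|su]; first by rewrite /= gE fE.
apply: st; apply: val_inj; apply/eqP; rewrite eqEfsubset (cattach_sub af) /=.
by rewrite su; exact: cattach_sub ag.
Qed.

Lemma cattach_exists (s t : csimplex) : val s `<=` val t -> s <> t ->
  exists f : cvert s -> cvert t, cattach f.
Proof.
move=> st nst; exists (fun x => [` fsubsetP st _ (valP x)]).
by split.
Qed.

Lemma cattach_face t (A : set (cvert t)) : A !=set0 -> A <> setT ->
  exists! p : {s : csimplex & cvert s -> cvert t},
    cattach (projT2 p) /\ range (projT2 p) = A.
Proof.
move=> [a0 Aa0] AT.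
pose s : {fset V} := [fset val x | x in [pred x : cvert t | `[< A x >]]]%fset.
have sP (x : cvert t) : val x \in s = `[< A x >].
  apply/imfsetP/idP => [[y /= Ay /val_inj -> //]|Ax].
  by exists x.
have st : s `<=` val t by apply/fsubsetP => x /imfsetP[y _ ->]; exact: valP.
have cs : is_clique s.
  apply/is_cliqueP; split.
    by move=> s0; have := sP a0; rewrite s0 inE => /esym/asboolP.
  have /is_cliqueP[_ h] := valP t.
  by move=> x y xs ys; apply: h; apply: (fsubsetP st).
pose S : csimplex := Sub s cs.
have SA (y : cvert t) : val y \in val S <-> A y.
  by rewrite /= sP; split=> /asboolP.
have nst : S <> t.
  move=> e; apply: AT; rewrite predeqE => x; split=> // _.
  by apply/SA; rewrite e; exact: valP.
have [f af] := cattach_exists (st : val S `<=` val t) nst.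
have [fE _] := af.
exists (existT _ S f); split.
  split=> //=; rewrite predeqE => y; split=> [[x _ <-]|Ay].
    by apply/SA; rewrite fE; exact: valP.
  have yS : val y \in val S by apply/SA.
  by exists [` yS] => //; apply: val_inj; rewrite fE.
move=> [S' f'] /= [[f'E nst'] f'A].
have eS : S' = S.
  apply: val_inj; apply/fsetP => x; apply/idP/idP => xS.
    have := f'E [` xS] => /= <-; apply/SA.
    by rewrite -f'A; exists [` xS].
  have xt : x \in val t by apply: (fsubsetP st).
  have : A [` xt] by apply/SA.
  by rewrite -f'A => -[y _ /(congr1 val)]; rewrite f'E /= => <-; exact: valP.
subst S'; congr existT; apply: funext => x; apply: val_inj.
by rewrite fE f'E.
Qed.

Definition clique_complex : gcomplex :=
  GComplex cvert_gt0 cattach_inj cattach_proper cattach_comp cattach_face.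

End CliqueComplex.

(* A complex whose simplices are identified with the finite cliques of a graph
   through the labels [lab] of their vertices; vertex links of a clique complex
   have this form without being literally clique complexes. *)
Section LabelledCliques.
Variables (Z : gcomplex) (V : choiceType) (E : rel V).
Variable lab : forall z : simplex Z, vert z -> V.
Hypothesis lab_inj : forall z, injective (@lab z).
Hypothesis lab_eq : forall z z', range (@lab z) = range (@lab z') -> z = z'.
Hypothesis lab_attach : forall z z' (f : vert z -> vert z'),
  attach f <-> (forall x, lab (f x) = lab x) /\ z <> z'.
Hypothesis lab_clique : forall z (x y : vert z), E (lab x) (lab y).
Hypothesis lab_surj : forall s : {fset V}, s <> fset0 ->
  {in s &, forall x y, E x y} -> exists z, range (@lab z) = [set` s].
Implicit Types z v w : simplex Z.

Lemma lab_boundary z z' : boundary z' z <->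
  (range (@lab z) `<=` range (@lab z'))%classic /\ z <> z'.
Proof.
split=> [[f /lab_attach[fE n]]|[h n]].
  by split=> // _ [x _ <-]; exists (f x).
have /choice[f fE] (x : vert z) : exists y : vert z', lab y = lab x.
  by have [|y _ yx] := h (lab x); [exists x|exists y].
by exists f; apply/lab_attach.
Qed.

Lemma lab_vertexP v : is_vertex v <-> exists a, range (@lab v) = [set a].
Proof.
split=> [/eqP/fintype1P[x xE]|[a aE]].
  exists (lab x); rewrite predeqE => b; split=> [[y _ <-]|->].
    by rewrite (xE y).
  by exists x.
have [x _ xa] : range (@lab v) a by rewrite aE.
apply/eqP/fintype1P; exists x => y; apply: lab_inj.
have : range (@lab v) (lab y) by exists y.
by rewrite aE xa.
Qed.

Lemma lab_vertex_exists a : E a a ->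
  exists2 v, is_vertex v & range (@lab v) = [set a].
Proof.
move=> Eaa; have [|x y|v hv] := @lab_surj [fset a]%fset.
- by move/fsetP/(_ a); rewrite !inE eqxx.
- by rewrite !inE => /eqP-> /eqP->.
have e : range (@lab v) = [set a].
  rewrite hv predeqE => b; split=> /= [|->]; last by rewrite inE.
  by rewrite inE => /eqP.
by exists v => //; apply/lab_vertexP; exists a.
Qed.

Lemma lab_adjacent v w a b : range (@lab v) = [set a] ->
  range (@lab w) = [set b] ->
  adjacent v w <-> a <> b /\ (E a b /\ E b a).
Proof.
move=> va wb.
have va' (x : vert v) : lab x = a.
  by have : range (@lab v) (lab x) by [exists x]; rewrite va.
have wb' (x : vert w) : lab x = b.
  by have : range (@lab w) (lab x) by [exists x]; rewrite wb.
have vv : is_vertex v by apply/lab_vertexP; exists a.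
have wv : is_vertex w by apply/lab_vertexP; exists b.
have [x0 _] : exists x : vert v, lab x = a.
  by have [x _ h] : range (@lab v) a by [rewrite va]; exists x.
have [y0 _] : exists x : vert w, lab x = b.
  by have [x _ h] : range (@lab w) b by [rewrite wb]; exists x.
split=> [[e [e2 _ _ [f [g [/lab_attach[fE _] /lab_attach[gE _] fg]]]]]|[ab [Eab
  Eba]]].
  have fa : lab (f x0) = a by rewrite fE.
  have gb : lab (g y0) = b by rewrite gE.
  split; last by rewrite -fa -gb; split; exact: lab_clique.
  move=> eab; have : (#|vert e| <= 1)%N.
    apply/fintype_le1P => x y; apply: lab_inj.
    have h (z : vert e) : lab z = a.
      have : (range f `|` range g)%classic z by rewrite fg.
      by case=> -[u _ <-]; rewrite ?fE ?gE // wb'.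
    by rewrite !h.
  by rewrite e2.
have Eaa : E a a by rewrite -(va' x0) lab_clique.
have Ebb : E b b by rewrite -(wb' y0) lab_clique.
have [|x y|e he] := @lab_surj [fset a; b]%fset.
- by move/fsetP/(_ a); rewrite !inE eqxx.
- by rewrite !inE => /orP[] /eqP-> /orP[] /eqP->.
have ea : range (@lab e) a by rewrite he /= !inE eqxx.
have eb : range (@lab e) b by rewrite he /= !inE eqxx orbT.
have sub u c : range (@lab u) = [set c] -> range (@lab e) c ->
    exists f : vert u -> vert e, attach f.
  move=> uc ec; suff : boundary e u by [].
  apply/lab_boundary; split=> [z|]; first by rewrite uc => ->.
  move=> ue; apply: ab.
  have ca : [set c] a by rewrite -uc ue.
  have cb : [set c] b by rewrite -uc ue.
  by rewrite ca cb.
have [f af] := sub _ _ va ea; have [g ag] := sub _ _ wb eb.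
have [fE _] := (lab_attach f).1 af; have [gE _] := (lab_attach g).1 ag.
exists e; split=> //; last first.
  exists f, g; split=> //; rewrite predeqE => z; split=> // _.
  have : range (@lab e) (lab z) by exists z.
  rewrite he /= !inE => /orP[] /eqP h; [left; exists x0|right; exists y0] => //.
    by apply: lab_inj; rewrite fE h va'.
  by apply: lab_inj; rewrite gE h wb'.
rewrite /is_edge.
have <- : #|[set: 'I_2]%SET| = 2%N by rewrite cardsT card_ord.
have [xa _ xae] := ea; have [xb _ xbe] := eb.
have -> : #|vert e| = #|[set xa; xb]%SET|.
  rewrite -cardsT; congr (#|pred_of_set _|); apply/setP => z; rewrite !inE.
  have : range (@lab e) (lab z) by exists z.
  rewrite he /= !inE => /orP[] /eqP h; apply/esym/orP.
    by left; apply/eqP/lab_inj; rewrite h.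
  by right; apply/eqP/lab_inj; rewrite h.
rewrite cards2 cardsT card_ord.
by case: eqP => // e'; case: ab; rewrite -xae -xbe e'.
Qed.

(** The vertices of a simplex of positive dimension belong to its boundary, so the boundary
    determines the labels and hence the simplex. *)
Lemma lab_simple : simple Z.
Proof.
split=> [e v jv|s t s1 t1 st].
  have vv : is_vertex v by case: jv.
  have [a va] := (lab_vertexP v).1 vv.
  have : adjacent v v by exists e.
  by move/(lab_adjacent va va) => [].
have key s' t' : (1 < #|vert s'|)%N -> boundary s' = boundary t' ->
    (range (@lab s') `<=` range (@lab t'))%classic.
  move=> s1' e _ [x _ <-].
  have [v vv ve] := lab_vertex_exists (lab_clique x x).
  have : boundary s' v.
    apply/lab_boundary; split=> [b|vs]; first by rewrite ve => ->; exists x.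
    by move: s1'; rewrite -vs vv.
  by rewrite e => /lab_boundary[h _]; apply: h; rewrite ve.
by apply: lab_eq; apply/seteqP; split; apply: key => //; rewrite st.
Qed.

Lemma lab_flag : flag Z.
Proof.
split; first exact: lab_simple.
move=> K finK [v0 Kv0] [Kv Kadj].
pose K' : set V := [set a | exists2 v, K v & range (@lab v) = [set a]].
have finK' : finite_set K'.
  have [k0 hk0] := (lab_vertexP v0).1 (Kv _ Kv0).
  (* The label of a vertex, with the dummy value [k0] for simplices that are not vertices. *)
  pose pt v := if pselect (exists a, range (@lab v) = [set a]) is left h
               then sval (cid h) else k0.
  apply: (sub_finite_set _ (finite_image pt finK)) => a [v Kv' va].
  exists v => //; rewrite /pt; case: pselect => [h|[]]; last by exists a.
  case: cid => /= b; rewrite va => e.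
  by have : [set a] a by []; rewrite e.
have [s sE] := finite_fsetP.1 finK'.
have Eaa v a : range (@lab v) = [set a] -> E a a.
  move=> va; have [x _ <-] : range (@lab v) a by rewrite va.
  exact: lab_clique.
have [|a b|z hz] := @lab_surj s.
- move=> s0; have [a va] := (lab_vertexP v0).1 (Kv _ Kv0).
  have : K' a by exists v0.
  by rewrite sE s0 /= inE.
- move=> sa sb; have : K' a by rewrite sE.
  have : K' b by rewrite sE.
  move=> [w Kw wb] [v Kv' va].
  have [vw|vw] := pselect (v = w).
    subst w; suff -> : b = a by apply: Eaa va.
    by have : [set b] b by []; rewrite -wb va.
  by have /(lab_adjacent va wb)[_ []] := Kadj _ _ Kv' Kw vw.
exists z; rewrite predeqE => v; split=> [[vv hv]|Kv'].
  have [a va] := (lab_vertexP v).1 vv.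
  have : K' a.
    rewrite sE -hz; case: hv => [<-|/lab_boundary[h _]]; first by rewrite va.
    by apply: h; rewrite va.
  move=> [w Kw wa]; suff -> : v = w by [].
  by apply: lab_eq; rewrite va wa.
have vv := Kv _ Kv'; split=> //.
have [a va] := (lab_vertexP v).1 vv.
have [->|vz] := pselect (v = z); first by left.
right; apply/lab_boundary; split=> // b; rewrite va => ->.
by rewrite hz -[_ a]/([set` s] a) -sE; exists v.
Qed.

Lemma lab_cycle n (c : 'I_n -> simplex Z) : (3 < n)%N ->
  cycle_without_diagonals c ->
  exists a : 'I_n -> V,
   [/\ forall i, E (a i) (a i), forall i, E (a i) (a (ordS i)) &
       forall i j, j <> i -> j <> ordS i -> i <> ordS j ->
         ~ (E (a i) (a j) /\ E (a j) (a i))].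
Proof.
move=> n3 [cv cinj cadj cdiag].
have /choice[a ha] (i : 'I_n) : exists a, range (@lab (c i)) = [set a].
  exact/lab_vertexP.
exists a; split.
- move=> i; have [x _ <-] : range (@lab (c i)) (a i) by rewrite ha.
  exact: lab_clique.
- by move=> i; have [_ []] := (lab_adjacent (ha i) (ha (ordS i))).1 (cadj i).
- move=> i j ji jS iS Eij; apply: (cdiag i j ji jS iS).
  apply/(lab_adjacent (ha i) (ha j)); split=> // aij.
  by apply/ji/cinj/lab_eq; rewrite !ha aij.
Qed.

End LabelledCliques.

(** * Vertex links as labelled clique complexes *)

Section CliqueLink.
Variables (V : choiceType) (E : rel V).
Hypothesis Esym : symmetric E.
Notation X := (clique_complex E).
Variables (v : simplex X) (x0 : V).
Hypothesis vE : val v = [fset x0].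

Definition link_graph : rel V := fun a b =>
  [&& E a b, E x0 a, E x0 b, a != x0 & b != x0].

Lemma link_val_in (p : simplex (link v)) (y : vert v) : val (link_map p y) = x0.
Proof.
have [h _] := link_map_attach p.
by rewrite h; apply/eqP; rewrite -(in_fset1 x0) -vE; exact: valP.
Qed.

Let y0 : vert v.
Proof. by apply: (FSetSub (_ : x0 \in _)); rewrite vE inE. Defined.

Definition link_lab (p : simplex (link v)) (y : vert p) : V := val (val y).

Lemma link_codom (p : simplex (link v)) (z : vert (projT1 p)) :
  (z \in codom (link_map p)) = (val z == x0).
Proof.
apply/codomP/eqP => [[y ->]|zx]; first exact: link_val_in.
by exists y0; apply: val_inj; rewrite link_val_in.
Qed.

Lemma x0_in_link (p : simplex (link v)) : x0 \in val (projT1 p).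
Proof. by rewrite -(link_val_in p y0); exact: valP. Qed.

Lemma link_lab_range (p : simplex (link v)) :
  range (@link_lab p) = [set` val (projT1 p) `\ x0].
Proof.
rewrite predeqE => a; split=> [[y _ <-]|].
  by rewrite /= in_fsetD1 /link_lab -link_codom (valP y); exact: valP.
rewrite /= in_fsetD1 => /andP[ax ap].
have ny : ([` ap] : vert (projT1 p)) \notin codom (link_map p).
  by rewrite link_codom.
by exists (Sub [` ap] ny).
Qed.

Lemma link_attach_unique (t : simplex X) (f f' : vert v -> vert t) :
  attach f -> attach f' -> f = f'.
Proof.
by move=> [fE _] [f'E _]; apply: funext => y; apply: val_inj; rewrite fE f'E.
Qed.

Lemma link_eq (p q : simplex (link v)) : projT1 p = projT1 q -> p = q.
Proof.
case: p q => [t f] [t' f'] /= e; subst t'; congr existT.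
by apply: val_inj; apply: link_attach_unique; exact: set_valP.
Qed.

Lemma link_lab_eq (p q : simplex (link v)) :
  range (@link_lab p) = range (@link_lab q) -> p = q.
Proof.
rewrite !link_lab_range => e; apply: link_eq; apply: val_inj; apply/fsetP => a.
have [->|ax] := eqVneq a x0; first by rewrite !x0_in_link.
have : [set` val (projT1 p) `\ x0] a = [set` val (projT1 q) `\ x0] a by rewrite
  e.
by rewrite /= !in_fsetD1 ax /= => h; apply/idP/idP; rewrite h.
Qed.

Lemma link_labP (p q : simplex (link v)) (k : vert p -> vert q) :
  attach k <-> (forall y, link_lab (k y) = link_lab y) /\ p <> q.
Proof.
split=> [[g [ag gE kE]]|[kE pq]].
  have [gval nt] := ag; split; last by move=> e; apply: nt; rewrite e.
  by move=> y; rewrite /link_lab kE gval.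
have nt : projT1 p <> projT1 q by move/link_eq.
have st : val (projT1 p) `<=` val (projT1 q).
  apply/fsubsetP => a ap.
  have [->|ax] := eqVneq a x0; first exact: x0_in_link.
  have : range (@link_lab p) a by rewrite link_lab_range /= in_fsetD1 ax.
  by move=> [y _ <-]; rewrite -kE; exact: valP.
have [g ag] := cattach_exists st nt; have [gE _] := ag.
exists g; split=> //.
  by apply: funext => y; apply: val_inj; rewrite /= gE !link_val_in.
by move=> y; apply: val_inj; rewrite gE; exact: kE.
Qed.

Lemma link_lab_clique (p : simplex (link v)) (y z : vert p) :
  link_graph (link_lab y) (link_lab z).
Proof.
have /is_cliqueP[_ h] := valP (projT1 p).
have yx (u : vert p) : link_lab u != x0 by rewrite /link_lab -link_codom;
  exact: (valP u).
have up (u : vert p) : link_lab u \in val (projT1 p) by exact: (valP (val u)).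
by rewrite /link_graph !h ?yx ?up ?x0_in_link.
Qed.

Lemma link_lab_surj (s : {fset V}) : s <> fset0 ->
  {in s &, forall x y, link_graph x y} ->
  exists p : simplex (link v), range (@link_lab p) = [set` s].
Proof.
move=> s0 hs.
have x0s : x0 \notin s.
  by apply/negP => h; have /and5P[_ _ _ /eqP] := hs _ _ h h.
have E00 : E x0 x0.
  by have /is_cliqueP[_] := valP v; apply; rewrite vE inE.
have ct : is_clique E (x0 |` s).
  apply/is_cliqueP; split.
    by move/fsetP/(_ x0); rewrite !inE eqxx.
  move=> a b; rewrite !inE => /orP[/eqP->|ha] /orP[/eqP->|hb] //.
  - by have /and3P[] := hs _ _ hb hb.
  - by rewrite Esym; have /and3P[] := hs _ _ ha ha.
  - by have /and3P[] := hs _ _ ha hb.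
pose t : simplex X := Sub (x0 |` s) ct.
have sub : val v `<=` val t by rewrite vE fsub1set /= !inE eqxx.
have nvt : v <> t.
  move=> e; apply: s0; apply/fsetP => a; rewrite inE; apply/negP => ha.
  have : a \in val v by rewrite e /= !inE ha orbT.
  by rewrite vE inE => /eqP ax; rewrite -ax ha in x0s.
have [f af] := cattach_exists sub nvt.
exists (existT _ t (SigSub (mem_set af))); rewrite link_lab_range /=.
by rewrite fsetU1K.
Qed.

End CliqueLink.

Section LocallySixLargeClique.
Variables (V : choiceType) (E : rel V).
Hypothesis Esym : symmetric E.
Hypothesis no_square : forall x c0 c1 c2 c3,
  {in [:: c0; c1; c2; c3], forall c, E x c /\ c <> x} ->
  E c0 c1 -> E c1 c2 -> E c2 c3 -> E c3 c0 ->
  ~ E c0 c2 -> ~ E c1 c3 -> False.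
Hypothesis no_pentagon : forall x c0 c1 c2 c3 c4,
  {in [:: c0; c1; c2; c3; c4], forall c, E x c /\ c <> x} ->
  E c0 c1 -> E c1 c2 -> E c2 c3 -> E c3 c4 ->
  E c4 c0 -> ~ E c0 c2 -> ~ E c0 c3 -> ~ E c1 c3 ->
  ~ E c1 c4 -> ~ E c2 c4 -> False.

Lemma clique_complex_6_large : locally_6_large (clique_complex E).
Proof.
move=> v vv.
have /cardfs1P [x0 vE] : #|` val v| == 1%N.
  by rewrite cardfE; apply/eqP; exact: vv.
have inj p : injective (@link_lab _ _ v p).
  by move=> y z /val_inj/val_inj.
split.
  by apply: (lab_flag inj (link_lab_eq vE) (link_labP vE) (link_lab_clique vE)
             (link_lab_surj Esym vE)).
move=> n c n45 hc.
have [|a [a0 a1 a2]] := lab_cycle inj (link_lab_eq vE) (link_labP vE)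
  (link_lab_clique vE) (link_lab_surj Esym vE) _ hc; first by case: n45 => ->.
have aE i : E x0 (a i) /\ a i <> x0.
  by have /and5P[_ ? _ /eqP] := a0 i.
have aS (i j : 'I_n) : val j = (i.+1 %% n)%N -> E (a i) (a j).
  move=> e; have -> : j = ordS i by apply: val_inj.
  by have /and5P[] := a1 i.
have aD (i j : 'I_n) :
  (val j != val i) && (val j != i.+1 %% n)%N && (val i != j.+1 %% n)%N ->
    ~ E (a i) (a j).
  move=> /andP[/andP[/eqP h1 /eqP h2] /eqP h3] Eij; apply: (a2 i j).
  - by move=> e; apply: h1; rewrite e.
  - by move/(congr1 val).
  - by move/(congr1 val).
  - have [h4 /eqP h5] := aE i; have [h6 /eqP h7] := aE j.
    by rewrite /link_graph [E (a j) _]Esym Eij h4 h5 h6 h7.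
case: n45 => n45; subst n.
  pose o k (hk : (k < 4)%N) := a (Ordinal hk).
  apply: (no_square (x := x0) (c0 := o 0 isT) (c1 := o 1 isT)
    (c2 := o 2 isT) (c3 := o 3 isT)); try exact: aS; try exact: aD.
  by move=> b; rewrite !inE => /or4P[] /eqP->; exact: aE.
pose o k (hk : (k < 5)%N) := a (Ordinal hk).
apply: (no_pentagon (x := x0) (c0 := o 0 isT) (c1 := o 1 isT)
  (c2 := o 2 isT) (c3 := o 3 isT) (c4 := o 4 isT)); try exact: aS;
    try exact: aD.
by move=> b; rewrite !inE => /or4P[| | |/orP[]] /eqP->; exact: aE.
Qed.

End LocallySixLargeClique.

(** * The realization of a clique complex *)

Import Order.TTheory GRing.Theory Num.Theory numFieldNormedType.Exports.

Local Open Scope classical_set_scope.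
Local Open Scope ring_scope.
Local Open Scope quotient_scope.

Lemma compact_set_type (T : topologicalType) (A : set T) :
  compact A -> compact [set: set_type A].
Proof.
move=> cA F PF _; have [|p [Ap clp]] := cA (set_val @ F) _.
  apply: (@filterS _ F _ setT _ _ filterT) => x _ /=.
  by rewrite set_valE; exact: set_valP.
exists (SigSub (mem_set Ap)); split=> // B C FB [C' [[O oO <-] /= Op OC]].
have nO : nbhs p O by apply: open_nbhs_nbhs; split.
have [|y [[z Bz <-] Oy]] := clp (set_val @` B) O _ nO.
  by apply: (@filterS _ F _ B _ _ FB) => x Bx; exists x.
by exists z; split=> //; apply: OC.
Qed.

Section RealContinuity.
Variables (R : realType) (T : topologicalType).
Implicit Types f g : T -> R.

Lemma sum_continuous (I : Type) (r : seq I) (P : pred I) (f : I -> T -> R) :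
  (forall i, P i -> continuous (f i)) ->
  continuous (fun t => \sum_(i <- r | P i) f i t).
Proof.
move=> cf t; elim: r => [|i r IH].
  by under eq_fun do rewrite big_nil; exact: cvg_cst.
under eq_fun do rewrite big_cons.
case: ifP => // Pi; apply: cvgD => //; exact: cf.
Qed.

Lemma dist_continuous f (c : R) : continuous f ->
  continuous (fun t => `|f t - c|).
Proof.
move=> cf t; apply: (@continuous_comp _ _ _ (fun t => f t - c) Num.norm).
  by apply: cvgB; [exact: cf|exact: cvg_cst].
exact: norm_continuous.
Qed.

Definition clamp (t : R) : R := Order.max 0 (Order.min 1 t).

Lemma clamp_continuous : continuous clamp.
Proof.
move=> t.
have h1 : {for t, continuous (fun t : R => Order.min 1 t : R^o)}.
  by apply: (@continuous_min R R (fun=> 1) id); [exact: cvg_cst|exact: cvg_id].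
have H := @continuous_max R R (fun=> 0) _ t (cvg_cst _) h1.
exact: H.
Qed.

End RealContinuity.

Section StdSimplexCompact.
Variables (R : realType) (W : finType).

Lemma std_simplex_compact : compact (@std_simplex R W).
Proof.
have cI : compact [set a : {ptws W -> R} | forall x, `[0, 1]%classic (a x)].
  apply: (@tychonoff W (fun=> R) (fun=> `[0, 1]%classic)) => x.
    exact: segment_compact.
have ev (x : W) : continuous (fun a : {ptws W -> R} => a x).
  exact: (@proj_continuous W (fun=> R) x).
apply: subclosed_compact cI _.
  have -> : @std_simplex R W =
     (\bigcap_x [set a : {ptws W ->
       R} | 0 <= a x]) `&` [set a | \sum_x a x = 1].
    by rewrite predeqE => a; split=> [[h1 h2]|[h1 h2]]; split=> // x;
      [move=> _|]; exact: h1.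
  apply: closedI.
    apply: closed_bigI => x _.
    by have /continuous_closedP H := ev x; exact: (H _ (@closed_ge _ 0)).
  have /continuous_closedP H :=
    @sum_continuous R _ W (index_enum W) predT _ (fun x _ => ev x).
  exact: (H _ (@closed_eq _ 1)).
move=> a [h1 h2] x; rewrite /= in_itv /= h1 -h2 (bigD1 x) //= lerDl.
by apply: sumr_ge0.
Qed.

End StdSimplexCompact.

(** * Barycentric coordinates *)

Section Coordinates.
Variables (R : realType) (V : choiceType) (E : rel V).
Notation X := (clique_complex E).
Notation pts := (simplex_points R X).
Notation real := (realization R X).

Definition mkpt (s : csimplex E) (a : set_type (@std_simplex R (cvert s))) :
  pts :=
  existT (fun s : simplex X => set_type (@std_simplex R (vert s))) s a.

(** The sum has at most one term, and none if [w] is not a vertex of the simplex; so the coordinate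
    is defined for every [w] without a membership proof. *)
Definition coord_pt (w : V) (p : pts) : R :=
  \sum_(y : cvert (projT1 p) | val y == w) val (projT2 p) y.

Lemma coord_pt_in s (a : set_type (@std_simplex R (cvert s))) w (h :
  w \in val s) :
  coord_pt w (mkpt a) = val a (FSetSub h).
Proof.
by rewrite /coord_pt (big_pred1 (FSetSub h)).
Qed.

Lemma coord_pt_out s (a : set_type (@std_simplex R (cvert s))) w :
  w \notin val s -> coord_pt w (mkpt a) = 0.
Proof.
move=> ws; rewrite /coord_pt big_pred0 // => y /=.
by apply/negP => /eqP e; move: ws; rewrite -e (valP y).
Qed.

Lemma coord_pt_ge0 w p : 0 <= coord_pt w p.
Proof. by apply: sumr_ge0 => y _; have [] := set_valP (projT2 p). Qed.

Lemma coord_pt_glue w (p q : pts) : Defs.glue p q ->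
  coord_pt w p = coord_pt w q.
Proof.
move: p q => [s a] [t b] [/= f [[fE _] ->]]; rewrite /coord_pt /=.
rewrite [RHS](_ : _ = \sum_(y :
  cvert t | val y == w) \sum_(x | f x == y) val a x) //.
rewrite (partition_big f (fun y => val y == w)) => /= [|x]; last by rewrite fE.
apply: eq_bigr => y /eqP yw; apply: eq_bigl => x.
case: (f x =P y) => [e|_]; rewrite ?andbF //.
by have := fE x; rewrite e /= yw => <-; rewrite eqxx.
Qed.

Lemma coord_pt_continuous w : continuous (coord_pt w).
Proof.
apply: (@sigT_continuous _ _ _ (fun s (a :
  set_type (@std_simplex R (cvert s))) =>
  \sum_(y : cvert s | val y == w) val a y)) => s.
apply: sum_continuous => y _.
have h1 : continuous (val : set_type (@std_simplex R (cvert s)) ->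
  {ptws cvert s -> R}).
  by rewrite -set_valE; exact: initial_continuous.
have h2 : continuous (fun a : {ptws cvert s -> R} => a y).
  exact: (@proj_continuous (cvert s) (fun=> R) y).
move=> a; have H := continuous_comp (h1 a) (h2 (val a)).
exact: H.
Qed.

Definition coord (w : V) (z : real) : R := coord_pt w (repr z).

Lemma coord_pi w (p : pts) : coord w (\pi_real p) = coord_pt w p.
Proof.
rewrite /coord; have : glue_equiv (repr (\pi_real p)) p.
  by apply/eqquotP; exact: (@reprK _ real).
move: (repr _) => q /asboolP H.
by elim: H => [u v /(coord_pt_glue w)|u|u v _ ->|u v u' _ -> _].
Qed.

Lemma coord_continuous w : continuous (coord w).
Proof.
apply/quotient_continuous.
have -> : coord w \o \pi_real = coord_pt w by apply/funext => p;
  rewrite /= coord_pi.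
exact: coord_pt_continuous.
Qed.

Lemma coord_ge0 w z : 0 <= coord w z. Proof. exact: coord_pt_ge0. Qed.

(** The simplex of a chosen representative; it may be larger than the set of vertices with positive
    coordinate, which is [support] below. *)
Definition carrier (z : real) : csimplex E := projT1 (repr z).

Lemma coord_out w z : w \notin val (carrier z) -> coord w z = 0.
Proof. by rewrite /coord /carrier; case: (repr z) => s a;
  exact: coord_pt_out. Qed.

Lemma coord_gt0_carrier w z : 0 < coord w z -> w \in val (carrier z).
Proof. by apply: contraLR => /coord_out ->; rewrite ltxx. Qed.

Lemma coord_clique z x y : 0 < coord x z -> 0 < coord y z -> E x y.
Proof.
move=> /coord_gt0_carrier hx /coord_gt0_carrier hy.
by have /is_cliqueP[_] := valP (carrier z); apply.
Qed.

Lemma coord_sum z (F : {fset V}) : (forall w, 0 < coord w z -> w \in F) ->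
  \sum_(w <- F) coord w z = 1.
Proof.
move=> hF.
have e1 : \sum_(w <- val (carrier z)) coord w z = 1.
  rewrite big_seq_fsetE /=.
  rewrite /coord /carrier; case: (repr z) => s a /=.
  have [_ <-] := set_valP a.
  by apply: eq_bigr => y _; rewrite coord_pt_in; congr (val a _);
    apply: val_inj.
rewrite -e1 (big_fsetID _ (mem (val (carrier z)))) /=.
rewrite [X in _ + X = _]big1_fset ?addr0; last first.
  by move=> w; rewrite !inE /= => /andP[_ /coord_out].
rewrite [RHS](big_fsetID _ (mem F)) /=.
rewrite [X in _ = _ + X]big1_fset ?addr0; last first.
  move=> w; rewrite !inE /= => /andP[_ wF] _; apply/eqP; rewrite -[_ == _]negbK.
  apply/negP => h; case/negP: wF; apply: hF.
  by rewrite lt_def h coord_ge0.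
by congr (\sum_(i <- enum_fset _) _); apply/fsetP => w; rewrite !inE /= andbC.
Qed.

End Coordinates.

Section Points.
Variables (R : realType) (V : choiceType) (E : rel V).
Notation X := (clique_complex E).
Notation pts := (simplex_points R X).
Notation real := (realization R X).
Notation coordR := (@coord R V E).

Lemma coord_pt_exists (s : csimplex E) (c : V -> R) :
  (forall w, 0 <= c w) -> (forall w, w \notin val s -> c w = 0) ->
  \sum_(w <- val s) c w = 1 ->
  exists a : set_type (@std_simplex R (cvert s)), forall w,
    coord_pt w (mkpt a) = c w.
Proof.
move=> c0 cs c1.
have h : @std_simplex R (cvert s) (fun y => c (val y)).
  by split=> [y|]; [exact: c0|rewrite -c1 [in RHS]big_seq_fsetE].
exists (SigSub (mem_set h)) => w; have [ws|ws] := boolP (w \in val s).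
  by rewrite (coord_pt_in _ ws).
by rewrite coord_pt_out // cs.
Qed.

Lemma coord_pt_glue_sub (s t : csimplex E) (a :
  set_type (@std_simplex R (cvert s)))
  (b : set_type (@std_simplex R (cvert t))) : (val s `<=` val t)%fset ->
  (forall w, coord_pt w (mkpt a) = coord_pt w (mkpt b)) ->
  \pi_real (mkpt a) = \pi_real (mkpt b).
Proof.
move=> st e; have [est|nst] := pselect (s = t).
  subst t; congr \pi_real; congr existT; apply: val_inj; apply/funext => y.
  have := e (val y); rewrite !(coord_pt_in _ (valP y)).
  by have -> : FSetSub (valP y) = y by apply: val_inj.
have [f af] := cattach_exists st nst; have [fE _] := af.
apply/eqquotP/asboolP; apply: rst_step; exists f; split=> //=.
apply: val_inj; apply/funext => y /=.
have := e (val y); rewrite (coord_pt_in _ (valP y)).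
have -> : FSetSub (valP y) = y by apply: val_inj.
move=> <-; rewrite /coord_pt /push /=; apply: eq_bigl => x.
by rewrite -(inj_eq val_inj) fE.
Qed.

Definition support (z : real) : {fset V} :=
  [fset w in val (carrier z) | 0 < coordR w z]%fset.

Lemma supportP z w : (w \in support z) = (0 < coordR w z).
Proof.
rewrite !inE /=; apply: andb_idl; exact: coord_gt0_carrier.
Qed.

Lemma support_clique z : is_clique E (support z).
Proof.
apply/is_cliqueP; split=> [s0|x y].
  have := @coord_sum R V E z (support z) (fun w => etrans (supportP z w)).
  rewrite s0 big_nil => /eqP; rewrite eq_sym oner_eq0 //.
by rewrite !supportP; exact: coord_clique.
Qed.

Lemma coord_notin_support z w : w \notin support z -> coordR w z = 0.
Proof.
by rewrite supportP lt_def coord_ge0 andbT negbK => /eqP.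
Qed.

(* A point is determined by its barycentric coordinates because it is the class
   of a point of the simplex spanned by its support. *)
Lemma coord_inj z z' : (forall w, coordR w z = coordR w z') -> z = z'.
Proof.
move=> e; pose s : csimplex E := Sub (support z) (support_clique z).
have [a ha] : exists a : set_type (@std_simplex R (cvert s)),
      forall w, coord_pt w (mkpt a) = coordR w z.
  apply: coord_pt_exists => [w|w|]; first exact: coord_ge0.
    exact: coord_notin_support.
  by apply: coord_sum => w; rewrite supportP.
have key u : (forall w, coordR w u = coordR w z) -> u = \pi_real (mkpt a).
  have [[t b] <-] : exists p : pts, \pi_real p = u.
    by exists (repr u); exact: (@reprK _ real).
  move=> eu; have eb w : coord_pt w (mkpt b) = coordR w z.
    by rewrite -coord_pi.
  have st : (val s `<=` val t)%fset.
    apply/fsubsetP => w; rewrite /= supportP -eb.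
    by apply: contraLR => wt; rewrite coord_pt_out // ltxx.
  by rewrite (coord_pt_glue_sub st (b := b)) // => w; rewrite ha eb.
by rewrite (key z) // (key z').
Qed.

Lemma point_exists (c : V -> R) (s : {fset V}) : is_clique E s ->
  (forall w, 0 <= c w) -> (forall w, w \notin s -> c w = 0) ->
  \sum_(w <- s) c w = 1 ->
  exists z, forall w, coordR w z = c w.
Proof.
move=> cs c0 co c1.
have [a ha] := @coord_pt_exists (Sub s cs) c c0 co c1.
by exists (\pi_real (mkpt a)) => w; rewrite coord_pi.
Qed.

Definition supported (F : {fset V}) : set real :=
  [set z | forall w, 0 < coordR w z -> w \in F].

(** A finite union of images of standard simplices, one for each clique contained in [F]; [insub]
    discards the other subsets. *)
Lemma supported_compact F : compact (supported F).
Proof.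
pose cell (s : {fset V}) : set real :=
  if insub s is Some s' then range (fun a =>
    \pi_real (@mkpt R V E s' a)) else set0.
have -> : supported F = \big[setU/set0]_(s <- fpowerset F) cell s.
  rewrite -bigcup_seq predeqE => z; split=> [zF|[s /= sF]].
    pose s : csimplex E := Sub (support z) (support_clique z).
    exists (support z).
      by rewrite /= fpowersetE; apply/fsubsetP => w; rewrite supportP;
        exact: zF.
    have [a ha] : exists a : set_type (@std_simplex R (cvert s)),
      forall w, coord_pt w (mkpt a) = coordR w z.
      apply: coord_pt_exists => [w|w|]; first exact: coord_ge0.
        exact: coord_notin_support.
      by apply: coord_sum => w; rewrite supportP.
    rewrite /cell insubT; first exact: support_clique.
    move=> cs; rewrite (bool_irrelevance cs (support_clique z)).
    by exists a => //; apply: coord_inj => w; rewrite coord_pi ha.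
  rewrite /cell; case: insubP => // s' _ s's [a _ <-] w; rewrite coord_pi => h.
  move: sF; rewrite fpowersetE -s's => /fsubsetP; apply.
  by apply: contraLR h => ws; rewrite coord_pt_out // ltxx.
apply: bigsetU_compact => s _; rewrite /cell; case: insubP => [s' _ _|_];
  last exact: compact0.
apply: continuous_compact; last exact/compact_set_type/std_simplex_compact.
apply: continuous_subspaceT => a.
have h1 := @existT_continuous _ (fun s :
  simplex X => set_type (@std_simplex R (vert s))) s' a.
have h2 := @pi_continuous pts {eq_quot (glue_equivRel R X)} (existT _ s' a).
have H := continuous_comp h1 h2; exact: H.
Qed.

(** The points over [F] outside an open [U] containing [H z0] form a compact set. The distance [d]
    to [H z0] in the coordinates has no zero there, since coordinates separate points, so its image
    is closed and misses 0. Thus [d (H z)] close to 0 forces [H z] into [U]. *)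
Lemma coord_criterion (Z : topologicalType) (H : Z -> real) (F : {fset V}) :
  (forall z, supported F (H z)) ->
    (forall w, continuous (fun z => coordR w (H z))) ->
  continuous H.
Proof.
move=> HF Hc z0 A nA.
pose d (y : real) : R := \sum_(w <- F) `|coordR w y - coordR w (H z0)|.
have dc : continuous d.
  by apply: sum_continuous => w _; apply: dist_continuous;
    exact: coord_continuous.
have dHc : continuous (d \o H).
  by apply: sum_continuous => w _; apply: dist_continuous; exact: Hc.
move: nA; rewrite nbhsE => -[U [oU Uz] UA].
have cK : compact (d @` (supported F `&` ~` U)).
  apply: continuous_compact; first exact: continuous_subspaceT.
  by apply: compact_closedI; [exact: supported_compact|exact: open_closedC].
have clK := compact_closed (@Rhausdorff R) cK.
have n0 : nbhs (d (H z0)) (~` (d @` (supported F `&` ~` U))).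
  apply: open_nbhs_nbhs; split; first exact: closed_openC.
  move=> [y [yF nU] dy]; apply: nU; suff -> : y = H z0 by [].
  have d0 : d y = 0.
    by rewrite dy /d big1 // => w _; rewrite subrr normr0.
  apply: coord_inj => w; have [wF|wF] := boolP (w \in F).
    have := d0; rewrite /d (big_fsetD1 w) //= => /eqP.
    rewrite paddr_eq0 ?sumr_ge0 // => /andP[].
    by rewrite normr_eq0 subr_eq0 => /eqP.
  have h u : supported F u -> coordR w u = 0.
    move=> uF; apply/eqP; apply: contraNT wF => h; apply: uF.
    by rewrite lt_def h coord_ge0.
  by rewrite !h.
apply: (@filterS _ (nbhs z0) _ _ (H @^-1` A) _ (dHc z0 _ n0)) => z hz;
  apply: UA.
by apply: contrapT => nU; apply: hz; exists (H z).
Qed.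

Hypothesis Efin : forall x, exists s : seq V, forall y, E x y -> y \in s.

(** Near [z], some coordinate [v] stays positive, so the supports stay among the finitely many
    neighbours of [v]. Compactness, used with the filter of large finite sets, yields one [F] for
    all of [K]. *)
Lemma compact_supported (K : set real) : compact K ->
  exists F, K `<=` supported F.
Proof.
have [N HN] := choice Efin.
move=> /compact_near_coveringP cK.
pose G := filter_from [set: {fset V}] (fun D => [set D' | (D `<=` D')%fset]).
have GF : Filter G.
  apply: filter_from_filter; first by exists fset0.
  move=> D D' _ _; exists (D `|` D')%fset => // D'' /= h.
  split; first exact: fsubset_trans (fsubsetUl _ _) h.
  exact: fsubset_trans (fsubsetUr _ _) h.
have [|D _ hD] := cK _ G (fun D z => supported D z) GF; last first.
  by exists D; apply: hD; exact: fsubset_refl.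
move=> z Kz; have /is_cliqueP[s0 _] := support_clique z.
have [v] : exists v, v \in support z by apply/fset0Pn/eqP.
rewrite supportP => vz.
exists ([set y | 0 < coordR v y], [set D' | ([fset y in N v] `<=` D')%fset]).
  split; last by exists [fset y in N v]%fset.
  apply: open_nbhs_nbhs; split=> //.
  have /continuousP h := @coord_continuous R V E v.
  exact: (h _ (@open_gt _ 0)).
move=> [y D'] [/= vy /fsubsetP ND'] w wy; apply: ND'.
by rewrite !inE /=; apply: HN; exact: (@coord_clique R V E y v w vy wy).
Qed.

End Points.

(** * Simple connectedness of collapsible clique complexes *)

Section Hat.
Variable R : realType.
Implicit Types a t : R.

Lemma clamp_ge0 t : 0 <= clamp t.
Proof. by rewrite /clamp le_max lexx. Qed.

Lemma clamp_le1 t : clamp t <= 1.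
Proof. by rewrite /clamp ge_max ler01 ge_min lexx. Qed.

Lemma clamp_id t : 0 <= t <= 1 -> clamp t = t.
Proof. by move=> /andP[t0 t1]; rewrite /clamp min_r // max_r. Qed.

Lemma clamp_le0 t : t <= 0 -> clamp t = 0.
Proof. by move=> t0; rewrite /clamp max_l // ge_min t0 orbT. Qed.

Lemma clamp_ge1 t : 1 <= t -> clamp t = 1.
Proof. by move=> t1; rewrite /clamp min_l // max_r. Qed.

Lemma clamp_mono t t' : t <= t' -> clamp t <= clamp t'.
Proof.
by move=> h; rewrite /clamp ge_max !le_max lexx /= le_min !ge_min lexx h !orbT.
Qed.

(* The hat functions at the integers, written as differences so that they
   telescope to a partition of unity. *)
Definition hat (k : nat) a : R := clamp (a + 1 - k%:R) - clamp (a - k%:R).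

Lemma hat_ge0 k a : 0 <= hat k a.
Proof. by rewrite subr_ge0; apply: clamp_mono; lra. Qed.

Lemma hat_sum n a : 0 <= a <= n%:R -> \sum_(0 <= k < n.+1) hat k a = 1.
Proof.
move=> /andP[a0 an].
rewrite (@telescope_sumr_eq _ _ _ (fun k => - clamp (a + 1 - k%:R))) //.
  rewrite clamp_le0 ?clamp_ge1 ?opprK; [lra|lra|].
  by rewrite -natr1; lra.
move=> k _; rewrite /hat opprK [RHS]addrC; congr (_ + - _).
by congr clamp; rewrite -natr1; lra.
Qed.

Lemma hat_gt0 k a : 0 < hat k a -> k%:R - 1 < a /\ a < k%:R + 1.
Proof.
rewrite /hat => h; split; rewrite ltNge; apply/negP => h'; move: h.
  by rewrite !clamp_le0 ?subrr ?ltxx //; lra.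
by rewrite !clamp_ge1 ?subrr ?ltxx //; lra.
Qed.

Lemma hat_neighbour k l a : 0 < hat k a -> 0 < hat l a ->
  [\/ k = l, l = k.+1 | k = l.+1].
Proof.
move=> /hat_gt0[k1 k2] /hat_gt0[l1 l2].
have h1 : (k < l.+2)%N by rewrite -(ltr_nat R) -!natr1; lra.
have h2 : (l < k.+2)%N by rewrite -(ltr_nat R) -!natr1; lra.
have : (k == l) || (l == k.+1) || (k == l.+1) by lia.
by move=> /orP[/orP[]|] /eqP h; [constructor 1|constructor 2|constructor 3].
Qed.

Lemma hat_nat k n : hat k n%:R = (k == n)%:R.
Proof.
rewrite /hat; case: ltngtP => kn.
- have h : k%:R + 1 <= n%:R :> R by rewrite natr1 ler_nat.
  by rewrite !clamp_ge1 ?subrr //; lra.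
- have h : n%:R + 1 <= k%:R :> R by rewrite natr1 ler_nat.
  by rewrite !clamp_le0 ?subrr //; lra.
- by rewrite kn subrr [_ + 1]addrC addrK clamp_ge1 // clamp_le0 // subr0.
Qed.

Lemma hat_continuous k : continuous (hat k).
Proof.
move=> a; apply: cvgB.
  apply: (@continuous_comp _ _ _ (fun a => a + 1 - k%:R) (@clamp R)).
    by apply: cvgB; [apply: cvgD;
      [exact: cvg_id|exact: cvg_cst]|exact: cvg_cst].
  exact: clamp_continuous.
apply: (@continuous_comp _ _ _ (fun a => a - k%:R) (@clamp R)).
  by apply: cvgB; [exact: cvg_id|exact: cvg_cst].
exact: clamp_continuous.
Qed.

End Hat.

(** * The homotopy defined by a chain of vertex maps *)

Section Homotopy.
Variables (R : realType) (V : choiceType) (E : rel V) (x0 : V).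
Hypothesis Esym : symmetric E.
Notation X := (clique_complex E).
Notation real := (realization R X).
Notation coordR := (@coord R V E).

Section Chain.
Variables (F : {fset V}) (n : nat) (f : nat -> V -> V).
Hypothesis f0 : forall x, x \in F -> E x x -> f 0 x = x.
Hypothesis fn : forall x, x \in F -> E x x -> f n x = x0.
Hypothesis fS : forall k x y, (k < n)%N -> x \in F -> y \in F -> E x y ->
  E x x -> E y y ->
  [/\ E (f k x) (f k y), E (f k x) (f k.+1 y) & E (f k.+1 x) (f k.+1 y)].

(* The coordinate at [w] of the point at time [a] on the track of [z]: at the
   integer time [k] the vertices of the support have been moved by [f k]. *)
Definition track (a : R) (z : real) (w : V) : R :=
  \sum_(0 <= k < n.+1) hat k a * \sum_(x <- F) coordR x z * (f k x == w)%:R.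

Lemma chain_level k x y : (k <= n)%N -> x \in F -> y \in F -> E x y ->
  E x x -> E y y ->
  E (f k x) (f k y).
Proof.
move=> kn xF yF Exy Ex Ey; have [kn'|] := ltnP k n;
  first by have [] := fS kn' xF yF Exy.
move=> nk; have {kn nk} -> : k = n by apply/eqP; rewrite eqn_leq kn.
case: n fn f0 fS => [|m] _ h0 hS; first by rewrite !h0.
by have [] := hS m x y.
Qed.

Definition track_carrier :
  {fset V} := (\bigcup_(k <- iota 0 n.+1) [fset f k x | x in F])%fset.

Lemma mem_track_carrier k x : (k <= n)%N -> x \in F -> f k x \in track_carrier.
Proof.
move=> kn xF; apply/bigfcupP; exists k;
  first by rewrite mem_iota /= add0n ltnS kn.
by apply/imfsetP; exists x.
Qed.

Lemma track_ge0 a z w : 0 <= track a z w.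
Proof.
apply: sumr_ge0 => k _; rewrite mulr_ge0 ?hat_ge0 //.
by apply: sumr_ge0 => x _; rewrite mulr_ge0 ?coord_ge0.
Qed.

Lemma track_gt0 a z w : 0 < track a z w ->
  exists k x, [/\ (k <= n)%N, x \in F, 0 < hat k a, 0 < coordR x z & f k x = w].
Proof.
move=> h; apply: contrapT => nh.
suff : track a z w = 0 by move=> e; rewrite e ltxx in h.
rewrite /track big_nat big1 // => k /andP[_ kn].
have [hk|hk] := eqVneq (hat k a) 0; first by rewrite hk mul0r.
rewrite big_seq big1 ?mulr0 // => x xF.
have [cx|cx] := eqVneq (coordR x z) 0; first by rewrite cx mul0r.
case: eqP => [fx|_]; last by rewrite mulr0.
case: nh; exists k, x; split=> //.
  by rewrite lt_def hk hat_ge0.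
by rewrite lt_def cx coord_ge0.
Qed.

Lemma track_sum a z : 0 <= a <= n%:R -> supported F z ->
  \sum_(w <- track_carrier) track a z w = 1.
Proof.
move=> an zF; rewrite /track exchange_big /=.
transitivity (\sum_(0 <= k < n.+1) hat k a); last exact: hat_sum.
rewrite big_nat [RHS]big_nat; apply: eq_bigr => k /andP[_ kn].
rewrite -mulr_sumr exchange_big /= -[RHS]mulr1; congr (_ * _).
transitivity (\sum_(x <- F) coordR x z); last exact: coord_sum.
rewrite big_seq [RHS]big_seq; apply: eq_bigr => x xF.
rewrite -mulr_sumr (big_fsetD1 (f k x)) /=; last exact: mem_track_carrier.
rewrite eqxx big1_fset ?addr0 ?mulr1 // => w; rewrite !inE => /andP[wx _] _.
by rewrite eq_sym (negbTE wx).
Qed.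

(** At any time at most two consecutive maps [f k] and [f k.+1] contribute, and [fS] says that their
    images of a clique form one clique. *)
Lemma track_clique a z w w' : 0 < track a z w -> 0 < track a z w' -> E w w'.
Proof.
move=> /track_gt0[k [x [kn xF hk cx <-]]] /track_gt0[l [y [ln yF hl cy <-]]].
have Exy := coord_clique cx cy; have Ex := coord_clique cx cx.
have Ey := coord_clique cy cy.
case: (hat_neighbour hk hl) => e; subst.
- exact: chain_level.
- by have [] := fS ln xF yF Exy Ex Ey.
- rewrite Esym; rewrite Esym in Exy.
  by have [] := fS kn yF xF Exy Ey Ex.
Qed.

Lemma track_point a z : 0 <= a <= n%:R -> supported F z ->
  exists z', forall w, coordR w z' = track a z w.
Proof.
move=> an zF; pose s := [fset w in track_carrier | 0 < track a z w]%fset.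
have sP w : (w \in s) = (0 < track a z w).
  rewrite !inE /=; apply: andb_idl => /track_gt0[k [x [kn xF _ _ <-]]].
  exact: mem_track_carrier.
have s0 w : w \notin s -> track a z w = 0.
  by rewrite sP lt_def track_ge0 andbT negbK => /eqP.
have s1 : \sum_(w <- s) track a z w = 1.
  rewrite -(track_sum an zF) [RHS](big_fsetID _ (mem s)) /=.
  rewrite [X in _ = _ + X]big1_fset ?addr0; last first.
    by move=> w; rewrite !inE /= => /andP[_ wF] _; apply: s0; rewrite !inE.
  congr (\sum_(i <- enum_fset _) _); apply/fsetP => w; rewrite !inE /=.
  by case: (w \in track_carrier).
apply: (point_exists (s := s)) => //; last exact: track_ge0.
apply/is_cliqueP; split=> [e|w w']; last by rewrite !sP; exact: track_clique.
by move: s1; rewrite e big_nil => /eqP; rewrite eq_sym oner_eq0.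
Qed.

(** The value [z] is a dummy for the case that no point has the coordinates [track a z]; by
    [track_point] this does not occur for [0 <= a <= n] and [z] over [F]. *)
Definition slide (a : R) (z : real) : real :=
  if pselect (exists z', forall w, coordR w z' = track a z w) is left h
  then sval (cid h) else z.

Lemma coord_slide a z w : 0 <= a <= n%:R -> supported F z ->
  coordR w (slide a z) = track a z w.
Proof.
move=> an zF; rewrite /slide; case: pselect => [h|[]]; last exact: track_point.
by case: cid => z' /= ->.
Qed.

Lemma slide_supported a z : 0 <= a <= n%:R -> supported F z ->
  supported track_carrier (slide a z).
Proof.
move=> an zF w; rewrite coord_slide // => /track_gt0[k [x [kn xF _ _ <-]]].
exact: mem_track_carrier.
Qed.

Lemma track_nat k z w : (k <= n)%N ->
  track k%:R z w = \sum_(x <- F) coordR x z * (f k x == w)%:R.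
Proof.
move=> kn; rewrite /track (bigD1_seq k) ?mem_index_iota ?iota_uniq //=.
rewrite hat_nat eqxx mul1r [X in _ + X]big1 ?addr0 // => l lk.
by rewrite hat_nat (negbTE lk) mul0r.
Qed.

Lemma slide0 z : supported F z -> slide 0 z = z.
Proof.
move=> zF; apply: coord_inj => w; rewrite coord_slide ?lexx ?ler0n //.
rewrite -[0]/(0%:R) track_nat //.
have [wF|wF] := boolP (w \in F).
  rewrite (big_fsetD1 w) //= big1_fset => [|x]; last first.
    rewrite !inE => /andP[xw xF] _.
    have [->|cx] := eqVneq (coordR x z) 0; first by rewrite mul0r.
    rewrite f0 ?(negbTE xw) ?mulr0 //.
    by apply: (@coord_clique R _ E z); rewrite lt_def cx coord_ge0.
  rewrite addr0; have [->|cw] := eqVneq (coordR w z) 0; first by rewrite mul0r.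
  rewrite f0 ?eqxx ?mulr1 //.
  by apply: (@coord_clique R _ E z); rewrite lt_def cw coord_ge0.
rewrite big_seq big1 => [|x xF].
  symmetry; apply/eqP; apply: contraNT wF => h; apply: zF.
  by rewrite lt_def h coord_ge0.
have [->|cx] := eqVneq (coordR x z) 0; first by rewrite mul0r.
rewrite f0 //; first by case: eqP => [e|_]; rewrite ?mulr0 //;
  rewrite e (negbTE wF) in xF.
by apply: (@coord_clique R _ E z); rewrite lt_def cx coord_ge0.
Qed.

Lemma track_end z w : supported F z -> track n%:R z w = (x0 == w)%:R.
Proof.
move=> zF; rewrite track_nat //.
transitivity ((\sum_(x <- F) coordR x z) * (x0 == w)%:R); last first.
  by rewrite coord_sum // mul1r.
rewrite mulr_suml.
rewrite big_seq [RHS]big_seq; apply: eq_bigr => x xF.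
have [->|cx] := eqVneq (coordR x z) 0; first by rewrite !mul0r.
rewrite fn //.
by apply: (@coord_clique R _ E z); rewrite lt_def cx coord_ge0.
Qed.

Lemma track_continuous (Z : topologicalType) (A : Z -> R) (g : Z -> real) w :
  continuous A -> continuous g -> continuous (fun q => track (A q) (g q) w).
Proof.
move=> cA cg; apply: sum_continuous => k _ q; apply: cvgM.
  by apply: continuous_comp; [exact: cA|exact: hat_continuous].
suff : continuous (fun q =>
  \sum_(x <- F) coordR x (g q) * (f k x == w)%:R) by apply.
apply: sum_continuous => x _ {}q; apply: cvgM; last exact: cvg_cst.
by apply: continuous_comp; [exact: cg|exact: coord_continuous].
Qed.

Lemma slide_continuous (Z : topologicalType) (A : Z -> R) (g : Z -> real) :
  continuous A -> (forall q, 0 <= A q <= n%:R) ->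
  continuous g -> (forall q, supported F (g q)) ->
  continuous (fun q => slide (A q) (g q)).
Proof.
move=> cA An cg gF; apply: (coord_criterion (F := track_carrier)) => [q|w].
  exact: slide_supported.
have -> : (fun q => coordR w (slide (A q) (g q))) = (fun q =>
  track (A q) (g q) w).
  by apply/funext => q; rewrite coord_slide.
exact: track_continuous.
Qed.

End Chain.

End Homotopy.

(** Loops can thus be replaced by maps that are continuous on the whole line, which avoids the
    subspace topology. *)
Lemma clamp_extension (R : realType) (T : topologicalType) (c : R -> T) :
  {within `[0, 1], continuous c} -> continuous (c \o @clamp R).
Proof.
move=> /subspace_continuousP cc t A nA.
have st : `[0, 1]%classic (clamp t) by rewrite /= in_itv /= clamp_ge0 clamp_le1.
have wA : nbhs (clamp t) [set s | `[0, 1]%classic s -> A (c s)] := cc _ st A nA.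
apply: (@filterS _ (nbhs t) _ _ _ _ (@clamp_continuous R t _ wA)) => s /=;
  apply.
by rewrite in_itv /= clamp_ge0 clamp_le1.
Qed.

Section RealAlgebra.
Variables (R : realType) (T : topologicalType).
Implicit Types f g : T -> R.

Lemma continuousMr f g : continuous f -> continuous g ->
  continuous (fun t => f t * g t).
Proof. by move=> cf cg t; apply: cvgM; [exact: cf|exact: cg]. Qed.

Lemma continuousDr f g : continuous f -> continuous g ->
  continuous (fun t => f t + g t).
Proof. by move=> cf cg t; apply: cvgD; [exact: cf|exact: cg]. Qed.

Lemma continuousNr f : continuous f -> continuous (fun t => - f t).
Proof. by move=> cf t; apply: cvgN; exact: cf. Qed.

Lemma continuousCr (a : R) : continuous (fun _ : T => a).
Proof. by move=> t; exact: cvg_cst. Qed.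

End RealAlgebra.

Lemma continuous_comp_all (T U W : topologicalType) (f : T -> U) (g : U -> W) :
  continuous f -> continuous g -> continuous (g \o f).
Proof. by move=> cf cg t; apply: continuous_comp; [exact: cf|exact: cg]. Qed.

(* The tracks of the base point [x] under a contraction of [c] are not constant.
   They are cut off: at time [u], the loop runs along the track of [x], follows
   [c] at height [loop_height], and runs back. For [u >= 1/4] the parameter
   [loop_param] of [c] is 0 or 1 unless [t] is in [1/4, 3/4]; for such [t] and
   [u <= 3/4] the height is maximal, where the contraction is constant. So from
   [u = 1/2] on, [c] may be replaced by the constant loop at [x]. *)
Section LoopParameters.
Variable R : realType.
Implicit Types q : R * R.

(** The product vanishes on the boundary of the unit square and is at least [(3/16)^2] on
    [[1/4, 3/4]^2], where the factor 64 raises it to [9/4], above 1. *)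
Definition loop_height q : R :=
  clamp (64 * (q.1 * (1 - q.1) * (q.2 * (1 - q.2)))).
Definition loop_param q : R := clamp (2^-1 + (q.2 - 2^-1) * (1 + 4 * q.1)).

Lemma fst_cont : continuous (fun q => q.1).
Proof. by move=> q; exact: cvg_fst. Qed.
Lemma snd_cont : continuous (fun q => q.2).
Proof. by move=> q; exact: cvg_snd. Qed.

Lemma loop_height_continuous : continuous loop_height.
Proof.
have cu (f : R * R -> R) : continuous f ->
  continuous (fun q => f q * (1 - f q)).
  move=> cf; apply: (continuousMr cf); apply: continuousDr (continuousNr cf).
  exact: continuousCr.
have H := continuousMr (@continuousCr R (R * R)%type 64)
  (continuousMr (cu _ fst_cont) (cu _ snd_cont)).
exact: (continuous_comp_all H (@clamp_continuous R)).
Qed.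

Lemma loop_param_continuous : continuous loop_param.
Proof.
have c1 := continuousDr snd_cont (@continuousCr R (R * R)%type (- 2^-1)).
have c2 := continuousMr (@continuousCr R (R * R)%type 4) fst_cont.
have H := continuousDr (@continuousCr R (R * R)%type 2^-1)
  (continuousMr c1 (continuousDr (@continuousCr R (R * R)%type 1) c2)).
exact: (continuous_comp_all H (@clamp_continuous R)).
Qed.

Lemma loop_height_top q : 4^-1 <= q.1 <= 3 / 4 -> 4^-1 <= q.2 <= 3 / 4 ->
  loop_height q = 1.
Proof.
move=> /andP[u1 u2] /andP[t1 t2]; apply: clamp_ge1.
have hu : 3 / 16 <= q.1 * (1 - q.1) by nra.
have ht : 3 / 16 <= q.2 * (1 - q.2) by nra.
nra.
Qed.

Lemma loop_param0 q : 4^-1 <= q.1 -> q.2 <= 4^-1 -> loop_param q = 0.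
Proof. by move=> h1 h2; apply: clamp_le0; nra. Qed.

Lemma loop_param1 q : 4^-1 <= q.1 -> 3 / 4 <= q.2 -> loop_param q = 1.
Proof. by move=> h1 h2; apply: clamp_ge1; nra. Qed.

End LoopParameters.

(** * Connectedness and simple connectedness *)

Section Contraction.
Variables (R : realType) (V : choiceType) (E : rel V) (x0 : V).
Hypothesis Esym : symmetric E.
Hypothesis Efin : forall x, exists s : seq V, forall y, E x y -> y \in s.
Hypothesis Ex0 : E x0 x0.
Hypothesis Ecoll : forall F : {fset V},
  collapsible E x0 (fun x => x \in F /\ E x x).
Notation X := (clique_complex E).
Notation real := (realization R X).
Notation coordR := (@coord R V E).

Lemma vertex_point : exists z : real, forall w, coordR w z = (x0 == w)%:R.
Proof.
apply: (point_exists (s := [fset x0]%fset)).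
- apply/is_cliqueP; split; first by move/fsetP/(_ x0); rewrite !inE eqxx.
  by move=> x y; rewrite !inE => /eqP-> /eqP->.
- by move=> w; rewrite ler0n.
- by move=> w; rewrite inE eq_sym => /negbTE ->.
- by rewrite big_seq_fset1 eqxx.
Qed.

Lemma slide_exists (F : {fset V}) : exists (n : nat) (sl : R -> real -> real),
  [/\ forall z, supported F z -> sl 0 z = z,
      forall z, supported F z -> forall w, coordR w (sl n%:R z) = (x0 == w)%:R &
      forall (Z : topologicalType) (A : Z -> R) (g : Z -> real),
        continuous A -> (forall q, 0 <= A q <= n%:R) ->
        continuous g -> (forall q, supported F (g q)) ->
        continuous (fun q => sl (A q) (g q))].
Proof.
have [n [f [f0 fn fS]]] := collapsible_chain (Ecoll F).
have f0' x : x \in F -> E x x -> f 0 x = x by move=> *; apply: f0.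
have fn' x : x \in F -> E x x -> f n x = x0 by move=> *; apply: fn.
have fS' k x y : (k < n)%N -> x \in F -> y \in F -> E x y -> E x x -> E y y ->
    [/\ E (f k x) (f k y), E (f k x) (f k.+1 y) & E (f k.+1 x) (f k.+1 y)].
  by move=> *; apply: fS.
exists n, (@slide R V E F n f); split.
- by move=> z zF; exact: (slide0 Esym f0' fn' fS').
- move=> z zF w; rewrite (coord_slide Esym f0' fn' fS') ?ler0n ?lexx //.
  exact: (track_end fn').
- move=> Z A g; exact: (slide_continuous Esym f0' fn' fS').
Qed.

Lemma realization_neq0 : [set: real] !=set0.
Proof. by have [z _] := vertex_point; exists z. Qed.

Lemma realization_connected : connected [set: real].
Proof.
have [b hb] := vertex_point.
have key z : exists C : set real, [/\ connected C, C z & C b].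
  have [F zF] := compact_supported Efin (@compact_set1 real z).
  have {}zF : supported F z by apply: zF.
  have [n [sl [sl0 sln slc]]] := slide_exists F.
  pose p (a : R) := sl (n%:R * clamp a) z.
  have pc : continuous p.
    apply: (slc R (fun a => n%:R * clamp a) (fun=> z)) => //.
    - by move=> a; apply: cvgM; [exact: cvg_cst|exact: clamp_continuous].
    - move=> a; rewrite mulr_ge0 ?ler0n ?clamp_ge0 //=.
      by rewrite ler_piMr ?ler0n ?clamp_le1.
    - by move=> a; exact: cvg_cst.
  exists (p @` `[0, 1]); split.
  - apply: connected_continuous_connected; first exact: segment_connected.
    exact: continuous_subspaceT.
  - exists 0; first by rewrite /= in_itv /= lexx ler01.
    by rewrite /p clamp_le0 // mulr0 sl0.
  - exists 1; first by rewrite /= in_itv /= lexx ler01.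
    by apply: coord_inj => w; rewrite /p clamp_ge1 // mulr1 sln.
have [C hC] := choice key.
have -> : [set: real] = \bigcup_(z in setT) C z.
  by rewrite predeqE => z; split=> // _; exists z => //; have [] := hC z.
apply: bigcup_connected => [|z _]; last by have [] := hC z.
by exists b => z _; have [] := hC z.
Qed.

Lemma realization_simply_connected : simply_connected R real.
Proof.
move=> x c [cc c0 c1].
pose c' := c \o @clamp R; have c'c : continuous c' := clamp_extension cc.
have cK : compact (c' @` `[0, 1]).
  by apply: continuous_compact;
    [exact: continuous_subspaceT|exact: segment_compact].
have [F KF] := compact_supported Efin cK.
have c'F t : supported F (c' t).
  apply: KF; exists (clamp t);
    first by rewrite /= in_itv /= clamp_ge0 clamp_le1.
  by rewrite /c' /= clamp_id // clamp_ge0 clamp_le1.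
have c'0 : c' 0 = x by rewrite /c' /= clamp_le0.
have c'1 : c' 1 = x by rewrite /c' /= clamp_ge1.
have xF : supported F x by rewrite -c'0.
have [n [sl [sl0 sln slc]]] := slide_exists F.
pose A (q : R * R) := n%:R * loop_height q.
have Ac : continuous A.
  by apply: continuousMr; [exact: continuousCr|exact: loop_height_continuous].
have An q : 0 <= A q <= n%:R.
  rewrite /A mulr_ge0 ?ler0n ?clamp_ge0 //=.
  by rewrite ler_piMr ?ler0n ?clamp_le1.
pose H1 (q : R * R) := sl (A q) (c' (loop_param q)).
pose H2 (q : R * R) := sl (A q) x.
have H1c : continuous H1.
  apply: slc => //; apply: continuous_comp_all c'c;
    exact: loop_param_continuous.
have H2c : continuous H2 by apply: slc => // q; exact: cvg_cst.
have H12 q : 4^-1 <= q.1 <= 3 / 4 -> H1 q = H2 q.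
  move=> hq; have /andP[hq1 _] := hq; rewrite /H1 /H2.
  have [t1|t1] := lerP q.2 4^-1.
    by rewrite loop_param0 // c'0.
  have [t2|t2] := lerP (3 / 4) q.2; first by rewrite loop_param1 // c'1.
  rewrite /A loop_height_top // ?mulr1; last by rewrite !ltW.
  by apply: coord_inj => w; rewrite !sln.
(* [H1] and [H2] agree on the whole strip around the seam, so [H] equals [H1] on the open set
   [q.1 < 3/4] and [H2] on the open set [q.1 > 1/4], which gives continuity. *)
pose H q := if q.1 < 2^-1 then H1 q else H2 q.
have HE1 q : q.1 < 3 / 4 -> H q = H1 q.
  move=> hq; rewrite /H; case: ltP => // h; rewrite H12 //; apply/andP; split;
    lra.
have HE2 q : 4^-1 < q.1 -> H q = H2 q.
  move=> hq; rewrite /H; case: ltP => // h; rewrite H12 //; apply/andP; split;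
    lra.
have Hc : continuous H.
  move=> q B; have [hq|hq] := ltP q.1 2^-1.
    have hq' : q.1 < 3 / 4 by lra.
    rewrite HE1 // => nB.
    have n1 : nbhs q [set q' : R * R | q'.1 < 3 / 4].
      exact: (@fst_cont R q _ (open_nbhs_nbhs (conj (@open_lt R (3 / 4)) hq'))).
    by apply: (@filterS2 _ (nbhs q) _ _ _ _ _ n1 (H1c q B nB)) => q' /= h;
      rewrite HE1.
  have hq' : 4^-1 < q.1 by lra.
  rewrite HE2 // => nB.
  have n1 : nbhs q [set q' : R * R | 4^-1 < q'.1].
    exact: (@fst_cont R q _ (open_nbhs_nbhs (conj (@open_gt R (4^-1)) hq'))).
  by apply: (@filterS2 _ (nbhs q) _ _ _ _ _ n1 (H2c q B nB)) => q' /= h;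
    rewrite HE2.
have h0 q : q.1 * (1 - q.1) * (q.2 * (1 - q.2)) = 0 -> A q = 0.
  by move=> e; rewrite /A /loop_height e mulr0 clamp_le0 // mulr0.
have slx : sl 0 x = x by exact: sl0.
exists H; split.
- exact: continuous_subspaceT.
- move=> t; rewrite in_itv /= => t01.
  rewrite HE1 /=; last by lra.
  rewrite /H1 h0 /=; last by ring.
  rewrite sl0 // /loop_param /= mulr0 addr0 mulr1 addrC subrK clamp_id //.
  by rewrite /c' /= clamp_id.
- by move=> t _; rewrite HE2 /=; [rewrite /H2 h0 //=; ring|lra].
- move=> u; rewrite in_itv /= => u01; split.
    rewrite /H; case: ifP => _; rewrite /H1 /H2 h0 /=; try by ring.
      rewrite /loop_param /= clamp_le0 ?c'0 //; nra.
    by [].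
  rewrite /H; case: ifP => _; rewrite /H1 /H2 h0 /=; try by ring.
    rewrite /loop_param /= clamp_ge1 ?c'1 //; nra.
  by [].
Qed.

End Contraction.

(** * Group actions on clique complexes *)

Section GraphAutomorphism.
Variables (V : choiceType) (E : rel V).
Variables (g h : V -> V).
Hypothesis gK : cancel g h.
Hypothesis hK : cancel h g.
Hypothesis gE : forall x y, E (g x) (g y) = E x y.
Notation X := (clique_complex E).

Lemma map_clique (s : {fset V}) : is_clique E s ->
  is_clique E [fset g x | x in s]%fset.
Proof.
move=> /is_cliqueP[s0 hs]; apply/is_cliqueP; split.
  move=> e; apply: s0; apply/fsetP => x; rewrite inE; apply/negP => xs.
  have : g x \in [fset g x | x in s]%fset by apply/imfsetP; exists x.
  by rewrite e inE.
by move=> _ _ /imfsetP[x /= xs ->] /imfsetP[y /= ys ->]; rewrite gE; apply: hs.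
Qed.

Definition map_simplex (s : csimplex E) :
  csimplex E := Sub _ (map_clique (valP s)).

Lemma map_vertP (s : csimplex E) (x : cvert s) :
  g (val x) \in val (map_simplex s).
Proof. by apply/imfsetP; exists (val x) => //; exact: valP. Qed.

Definition map_vert (s : csimplex E) (x : cvert s) : cvert (map_simplex s) :=
  FSetSub (map_vertP x).

Lemma map_vert_bij s : bijective (@map_vert s).
Proof.
apply: inj_card_bij.
  by move=> x y /(congr1 val) /(can_inj gK) /val_inj.
rewrite -!cardfE card_imfset //; exact: can_inj gK.
Qed.

Lemma map_attach (s t : csimplex E) (f : cvert s -> cvert t)
    (f' : cvert (map_simplex s) -> cvert (map_simplex t)) :
  f' \o @map_vert s = @map_vert t \o f -> (cattach f <-> cattach f').
Proof.
move=> e; have e' x : val (f' (map_vert x)) = g (val (f x)).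
  by have /(congr1 val) := congr1 (@^~ x) e.
have [k k1 k2] := map_vert_bij s.
have inj : map_simplex s = map_simplex t -> s = t.
  move=> /(congr1 val) /= est; apply: val_inj; apply/fsetP => x.
  have H (u : csimplex E) :
    (x \in val u) = (g x \in [fset g x | x in val u]%fset).
    apply/idP/imfsetP => [xu|[y /= yu /(can_inj gK) -> //]].
    by exists x.
  by rewrite !H est.
split=> [[fE st]|[fE st]].
  split=> [y|/inj //]; rewrite -(k2 y) e' fE //.
split=> [x|st']; last by apply: st; rewrite st'.
by apply: (can_inj gK); rewrite -e' fE.
Qed.

End GraphAutomorphism.

Section GraphAutomorphismCoordinates.
Variables (V : choiceType) (E : rel V).
Variables (g h : V -> V).
Hypothesis gK : cancel g h.
Hypothesis hK : cancel h g.
Hypothesis gE : forall x y, E (g x) (g y) = E x y.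
Notation X := (clique_complex E).

Lemma inverse_adj x y : E (h x) (h y) = E x y.
Proof. by rewrite -gE !hK. Qed.

Lemma map_simplex_bij : bijective (map_simplex gE).
Proof.
exists (map_simplex inverse_adj) => s; apply: val_inj; apply/fsetP => x /=.
  apply/imfsetP/idP => [[y /= /imfsetP[z /= zs ->] ->]|xs]; first by rewrite gK.
  by exists (g x); rewrite ?gK //=; apply/imfsetP; exists x.
apply/imfsetP/idP => [[y /= /imfsetP[z /= zs ->] ->]|xs]; first by rewrite hK.
by exists (h x); rewrite ?hK //=; apply/imfsetP; exists x.
Qed.

Definition graph_automorphism : automorphism X :=
  @Automorphism X (map_simplex gE) (@map_vert V E g gE) map_simplex_bij
    (map_vert_bij gK gE) (map_attach gK (gE := gE)).

Lemma coord_automorphism (R : realType) w (z : realization R X) :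
  coord w (aut_real graph_automorphism z) = coord (h w) z.
Proof.
have [[s a] <-] : exists p : simplex_points R X, \pi_(realization R X) p = z.
  by exists (repr z); exact: (@reprK _ (realization R X)).
rewrite aut_real_pi !coord_pi /coord_pt /= /push.
rewrite [RHS](partition_big (@map_vert V E g gE s) (fun y => val y == w)) /=;
  last first.
  by move=> x /eqP xw; rewrite xw hK.
apply: eq_bigr => y /eqP yw; apply: eq_bigl => x;
  apply/esym/andb_idl => /eqP xy.
by rewrite -yw -xy /= gK.
Qed.

End GraphAutomorphismCoordinates.

Section GroupAction.
Variables (V : choiceType) (E : rel V) (G : groupType) (op : G -> V -> V).
Hypothesis op1 : forall x, op 1%g x = x.
Hypothesis opM : forall g h x, op (g * h)%g x = op g (op h x).
Hypothesis opE : forall g x y, E (op g x) (op g y) = E x y.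
Notation X := (clique_complex E).

Lemma opK g : cancel (op g) (op g^-1%g).
Proof. by move=> x; rewrite -opM mulVg op1. Qed.

Lemma opKV g : cancel (op g^-1%g) (op g).
Proof. by move=> x; rewrite -opM mulgV op1. Qed.

Definition clique_action (g : G) : automorphism X :=
  graph_automorphism (opK g) (opKV g) (opE g).

Lemma corner_eq (c c' : corner X) : val (projT1 c) = val (projT1 c') ->
  val (projT2 c) = val (projT2 c') :> V -> c = c'.
Proof.
by case: c c' => [s x] [s' x'] /= /val_inj e; subst s' => /val_inj ->.
Qed.

Lemma clique_action_is_action : Defs.is_action clique_action.
Proof.
split=> [c|g h c]; apply: corner_eq => /=.
- apply/fsetP => x; apply/imfsetP/idP => [[y /= yc ->]|xc];
  first by rewrite op1.
  by exists x; rewrite ?op1.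
- exact: op1.
- apply/fsetP => x; apply/imfsetP/imfsetP =>
  [[y /= yc ->]|[y /= /imfsetP[u /= uc ->] ->]].
    by exists (op h y); rewrite ?opM //; apply/imfsetP; exists y.
  by exists u; rewrite ?opM.
- exact: opM.
Qed.

Variable R : realType.
Notation real := (realization R X).
Hypothesis Efin : forall x, exists s : seq V, forall y, E x y -> y \in s.

Lemma coord_clique_action g w (z : real) :
  coord w (aut_real (clique_action g) z) = coord (op g^-1%g w) z.
Proof. exact: coord_automorphism. Qed.

(** If [K] lies over [F] and [g K] meets [K], then [g] sends some vertex in [F] to a vertex in [F];
    there are finitely many such pairs. *)
Lemma clique_action_proper :
  (forall x y, E x x -> finite_set [set g | op g x = y]) ->
  proper_action clique_action R.
Proof.
move=> fin K cK; have [F KF] := compact_supported Efin cK.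
apply: (@sub_finite_set _ _ (\bigcup_(p in [set` [seq p <- allpairs pair F F |
  E p.1 p.1]])
   [set g | op g p.1 = p.2])).
  move=> g [_ [[z Kz <-] Kgz]].
  have /is_cliqueP[s0 _] := support_clique z.
  have [x] : exists x, x \in support z by apply/fset0Pn/eqP.
  rewrite supportP => xz; exists (x, op g x) => //=.
  rewrite mem_filter /= (coord_clique xz xz) /=; apply/allpairsP.
  exists (x, op g x); split=> //=; first exact: KF xz.
  by apply: (KF _ Kgz); rewrite coord_clique_action opK.
apply: bigcup_finite; first exact: finite_seq.
by move=> [x y] /=; rewrite mem_filter /= => /andP[Ex _]; exact: fin.
Qed.

(** The compact set consists of the points supported near [x0]: if [g x0] is in the support of [z],
    then [g^-1] moves [z] into it. *)
Lemma clique_action_cocompact x0 :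
  (forall x, E x x -> exists g, op g x0 = x) ->
    cocompact_action clique_action R.
Proof.
move=> trans; have [s hs] := Efin x0.
exists (supported [fset y in s]%fset); first exact: supported_compact.
rewrite predeqE => z; split=> // _.
have /is_cliqueP[s0 _] := support_clique z.
have [x] : exists x, x \in support z by apply/fset0Pn/eqP.
rewrite supportP => xz; have [g gx] := trans x (coord_clique xz xz).
exists g => //; exists (aut_real (clique_action g^-1%g) z).
  move=> w; rewrite coord_clique_action invgK => wz.
  by rewrite !inE /=; apply: hs; rewrite -(opE g) gx;
    exact: (coord_clique xz wz).
by apply: coord_inj => w; rewrite !coord_clique_action invgK opKV.
Qed.

End GroupAction.

(** * The even group and its systolic complex *)

Local Notation vgraph := (@pgraph stateTree letterTree).

Lemma pgraph_actw w (x y : vertex) : ~~ odd (size w) ->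
  vgraph (actw w x) (actw w y) = vgraph x y.
Proof.
have key u (x' y' : vertex) : ~~ odd (size u) -> vgraph x' y' ->
    vgraph (actw u x') (actw u y').
  move=> u0 /and3P[px py h]; apply/and3P; split.
  - by rewrite parity_actw (negbTE u0).
  - by rewrite parity_actw (negbTE u0).
  rewrite actw_adj1 actw_adj2; case/orP: h => [-> //|/andP[/eqP e h]].
  apply/orP; right; rewrite (actw_snd u e) eqxx /=.
  case/siblingsP: h => [e1|[a [h1 h2]]].
    by rewrite (actw_fst u e1) siblings_refl.
  by apply: (siblings_middle (a := (actw u (a, x'.2)).1)); rewrite actw_adj1.
move=> w0; apply/idP/idP; last exact: key.
by move/(@key (winv w) _ _); rewrite size_winv !actwK; apply.
Qed.

Lemma pgraph_even_group (g : even_group) (x y : vertex) :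
  vgraph (val g x) (val g y) = vgraph x y.
Proof. by have [w [w0 ->]] := even_wordP g; exact: pgraph_actw. Qed.

(** By freeness the set has at most one element. *)
Lemma even_group_stabilizer (x y : vertex) :
  finite_set [set g : even_group | val g x = y].
Proof.
have [[g0 h0]|n0] := pselect (exists g : even_group, val g x = y).
  apply: (@sub_finite_set _ _ [set g0]); last exact: finite_set1.
  move=> g /= h; apply: val_inj; apply/funext => v.
  have [w [_ e]] := even_wordP g; have [w' [_ e']] := even_wordP g0.
  rewrite e e'; apply: (@actw_free w w' x).
  by rewrite -e -e'; exact: etrans h (esym h0).
apply: (@sub_finite_set _ _ set0) => // g h; apply: n0; exists g; exact: h.
Qed.

Lemma even_group_transitive (x : vertex) : vgraph x x ->
  exists g : even_group, val g base = x.
Proof.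
case/and3P=> px _ _; have [w wx] := actw_transitive x.
(* Every generator changes the parity, and both [base] and [x] are even. *)
have w0 : ~~ odd (size w).
  by move: px; rewrite -wx parity_actw /= addbF.
by exists (even_elt w); rewrite val_even_elt.
Qed.

Lemma vgraph_collapsible (F : {fset vertex}) :
  collapsible vgraph base (fun x => x \in F /\ vgraph x x).
Proof.
have r0 : tadj (root stateTree) (Sub [:: None] isT : stateTree) by [].
apply: collapsible_sub (pgraph_collapsible letterTree r0
  (\max_(x <- enum_fset F) level x.1) (\max_(x <- enum_fset F) level x.2)).
move=> x [xF /and3P[px _ _]]; split=> //.
  exact: (@leq_bigmax_seq _ _ predT (fun x : vertex => level x.1) _ xF isT).
exact: (@leq_bigmax_seq _ _ predT (fun x : vertex => level x.2) _ xF isT).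
Qed.

Lemma systolic_complex (R : realType) : systolic R (clique_complex vgraph).
Proof.
have Esym : symmetric vgraph by move=> x y; exact: pgraphC.
have Ebase : vgraph base base by apply: pgraph_refl.
split.
- exact: realization_neq0 Ebase.
- exact: (realization_connected Esym (@pgraph_finite _ _) Ebase
  vgraph_collapsible).
- exact: (realization_simply_connected Esym (@pgraph_finite _ _)
  vgraph_collapsible).
- apply: clique_complex_6_large => //.
  + exact: no_square_link.
  + exact: no_pentagon_link.
Qed.

Theorem corollary1p9 (R : realType) :
  exists G : groupType, systolic_group R G /\ ~ residually_finite G.
Proof.
exists even_group; split; last first.
  have [g g1 hg] := even_group_not_residually_finite => rf.
  by have [F [f []]] := rf g g1; exact: hg.
pose op (g : even_group) (x : vertex) : vertex := val g x.
have op1 x : op 1%g x = x by [].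
have opM g h x : op (g * h)%g x = op g (op h x) by [].
exists (clique_complex vgraph), (clique_action op1 opM pgraph_even_group);
  split.
- exact: systolic_complex.
- exact: clique_action_is_action.
- apply: clique_action_proper; first exact: pgraph_finite.
  by move=> x y _; exact: even_group_stabilizer.
- apply: (@clique_action_cocompact _ _ _ op _ _ _ _ _ base).
    exact: pgraph_finite.
  exact: even_group_transitive.
Qed.
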